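(* Let $n\ge5$ and let $\mathcal{G}=\{G_i \mid i\in\mathbb{Z}/n\mathbb{Z}\}$ be a collection of non-trivial groups. The automorphism group $\mathrm{Aut}(C_n\mathcal{G})$ acts by isometries on the (polygonal) Davis complex $X$ of $C_n\mathcal{G}$ via $$\varphi\cdot kH=\varphi(k)\,\varphi(H)\quad\text{for every }\varphi\in\mathrm{Aut}(C_n\mathcal{G})\text{ and every }kH\in X^{(0)}.$$ Moreover, this action extends the action of $C_n\mathcal{G}$ on $X$ if one identifies canonically $C_n\mathcal{G}$ with $\mathrm{Inn}(C_n\mathcal{G})$.
   Context: The cyclic product $C_n\mathcal{G}$ is the quotient of the free product $\ast_{i} G_i$ by the relations $gh=hg$ for all $g\in G_i$, $h\in G_{i+1}$, $i\in\mathbb{Z}/n\mathbb{Z}$ (indices modulo $n$). Each $G_i$ embeds in $C_n\mathcal{G}$ and $\langle G_i,G_{i+1}\rangle=G_i\times G_{i+1}$. The polygonal complex $X$ is defined as follows: its set of vertices $X^{(0)}$ consists of the left cosets $kH$ with $k\in C_n\mathcal{G}$ and $H=\langle G_i,G_{i+1}\rangle$ for some $i\in\mathbb{Z}/n\mathbb{Z}$; for every $g\in C_n\mathcal{G}$ and every $i$ there is an edge between $g\langle G_i,G_{i+1}\rangle$ and $g\langle G_{i+1},G_{i+2}\rangle$; and for every $g\in C_n\mathcal{G}$ there is an $n$-gon with boundary the $n$-cycle $g\langle G_1,G_2\rangle, g\langle G_2,G_3\rangle,\dots,g\langle G_n,G_1\rangle$. The group $C_n\mathcal{G}$ acts on $X$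 by left multiplication on cosets. The cubical subdivision of $X$, in which each $n$-gon is divided into $n$ squares (one per corner), is the Davis complex of $C_n\mathcal{G}$, a CAT(0) square complex, and $X$ is endowed with the corresponding CAT(0) metric. $\mathrm{Inn}(C_n\mathcal{G})$ denotes the group of inner automorphisms; $C_n\mathcal{G}$ has trivial centre, and $g\in C_n\mathcal{G}$ is identified with the inner automorphism $x\mapsto gxg^{-1}$.
   Formalization: Literally φ(k)φ(H) need not be a vertex (for φ inner by g it is gkHg⁻¹), so the formula is read up to right translation: φ·kH is the unique vertex that is a right translate of φ(k)φ(H); this agrees with the literal formula whenever φ(k)φ(H) is itself a vertex. *)

(* Defs.v *)
From HB Require Import structures.
From mathcomp Require Import all_boot all_order all_algebra.
From mathcomp Require Import all_classical all_reals.
From mathcomp Require Import interval_inference.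
Set Implicit Arguments.
Unset Strict Implicit.
Unset Printing Implicit Defensive.
Import Order.TTheory GRing.Theory Num.Theory.

Local Open Scope classical_set_scope.
Local Open Scope quotient_scope.
Local Open Scope group_scope.

Definition is_subgroup (A : groupType) (K : set A) : Prop :=
  [/\ K 1, (forall x y, K x -> K y -> K (x * y)) & (forall x, K x -> K x^-1)].

Definition lcoset (A : groupType) (k : A) (K : set A) : set A :=
  [set k * h | h in K].

Definition rtranslate (A : groupType) (K : set A) (g : A) : set A :=
  [set h * g | h in K].

Section Automorphisms.
Variable A : groupType.

Record automorphism := Automorphism {
  aut_fun :> A -> A;
  aut_bij : bijective aut_fun;
  autM : {morph aut_fun : x y / x * y} }.

HB.instance Definition _ := gen_eqMixin automorphism.
HB.instance Definition _ := gen_choiceMixin automorphism.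

Lemma aut_ext (f g : automorphism) : f =1 g -> f = g.
Proof.
case: f g => [f fb fM] [g gb gM] /= /funext fg; subst g.
by rewrite (Prop_irrelevance fb gb) (Prop_irrelevance fM gM).
Qed.

Definition aut1 : automorphism :=
  @Automorphism id (Bijective (fun=> erefl) (fun=> erefl)) (fun _ _ => erefl).

Lemma aut_mul_morph (f g : automorphism) :
  {morph (f \o g) : x y / x * y}.
Proof. by move=> x y /=; rewrite !autM. Qed.

Definition aut_mul (f g : automorphism) : automorphism :=
  Automorphism (bij_comp (aut_bij f) (aut_bij g)) (@aut_mul_morph f g).

Lemma aut_inv_ex (f : automorphism) :
  exists g : automorphism, cancel f g /\ cancel g f.
Proof.
have [g fK gK] := aut_bij f.
have gM : {morph g : x y / x * y}.
  by move=> x y; apply: (can_inj fK); rewrite autM !gK.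
by exists (Automorphism (Bijective gK fK) gM).
Qed.

Definition aut_inv (f : automorphism) : automorphism := projT1 (cid (aut_inv_ex f)).

Lemma aut_mulA : associative aut_mul.
Proof. by move=> f g h; apply: aut_ext. Qed.

Lemma aut_mul1g : left_id aut1 aut_mul.
Proof. by move=> f; apply: aut_ext. Qed.

Lemma aut_mulg1 : right_id aut1 aut_mul.
Proof. by move=> f; apply: aut_ext. Qed.

Lemma aut_mulVg : left_inverse aut1 aut_inv aut_mul.
Proof.
move=> f; apply: aut_ext => x /=; rewrite /aut_inv.
by case: cid => g /= [fK _]; exact: fK.
Qed.

Lemma aut_mulgV : right_inverse aut1 aut_inv aut_mul.
Proof.
move=> f; apply: aut_ext => x /=; rewrite /aut_inv.
by case: cid => g /= [_ gK]; exact: gK.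
Qed.

HB.instance Definition _ := isGroup.Build automorphism
  aut_mulA aut_mul1g aut_mulg1 aut_mulVg aut_mulgV.

(* The library's [x ^ g] is [g^-1 * x * g], the opposite convention. *)
Definition inner_fun (g x : A) : A := g * x * g^-1.

Lemma inner_bij g : bijective (inner_fun g).
Proof.
exists (inner_fun g^-1) => x; rewrite /inner_fun invgK.
  by rewrite -!mulgA mulVg mulg1 mulKg.
by rewrite -!mulgA mulgV mulg1 mulVKg.
Qed.

Lemma inner_morph g : {morph inner_fun g : x y / x * y}.
Proof. by move=> x y; rewrite /inner_fun -!mulgA mulKg. Qed.

Definition inner (g : A) : automorphism :=
  Automorphism (inner_bij g) (@inner_morph g).

End Automorphisms.

Definition is_action (A : groupType) (X : Type) (act : A -> X -> X) : Prop :=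
  (forall x, act 1 x = x) /\ (forall a b x, act (a * b) x = act a (act b x)).

(* Indices live in Z/n, represented by ['I_n] with successor [ordS]. *)
Section CyclicProduct.
Variables (n : nat) (G : 'I_n -> groupType).

Definition syllable := {i : 'I_n & G i}.
Definition syl (i : 'I_n) (a : G i) : syllable := existT _ i a.

(* [word_one] and [word_mul] present the free product of the groups [G i];
   [word_comm] adds the defining relations of the cyclic product. *)
Inductive word_eq : seq syllable -> seq syllable -> Prop :=
| word_refl u : word_eq u u
| word_sym u v : word_eq u v -> word_eq v u
| word_trans u v w : word_eq u v -> word_eq v w -> word_eq u w
| word_cat u u' v v' : word_eq u u' -> word_eq v v' -> word_eq (u ++ v) (u' ++ v')
| word_one i : word_eq [:: syl (1 : G i)] [::]
| word_mul i (a b : G i) : word_eq [:: syl a; syl b] [:: syl (a * b)]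
| word_comm i (a : G i) (b : G (ordS i)) :
    word_eq [:: syl a; syl b] [:: syl b; syl a].

Definition word_eqb : rel (seq syllable) := fun u v => `[< word_eq u v >].

Lemma word_eqb_refl : reflexive word_eqb.
Proof. by move=> u; apply/asboolP; exact: word_refl. Qed.
Lemma word_eqb_sym : symmetric word_eqb.
Proof. by move=> u v; apply/asboolP/asboolP; exact: word_sym. Qed.
Lemma word_eqb_trans : transitive word_eqb.
Proof.
by move=> v u w /asboolP uv /asboolP vw; apply/asboolP; exact: word_trans vw.
Qed.

Canonical word_equiv := EquivRel word_eqb word_eqb_refl word_eqb_sym word_eqb_trans.

Definition cyclic_product := {eq_quot word_equiv}.
HB.instance Definition _ := Choice.on cyclic_product.
HB.instance Definition _ := EqQuotient.on cyclic_product.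

Definition word_class (u : seq syllable) : cyclic_product := \pi_cyclic_product u.

Lemma word_piP u v : word_class u = word_class v <-> word_eq u v.
Proof.
rewrite /word_class; split => [/eqP|uv]; first by rewrite piE => /asboolP.
by apply/eqP; rewrite piE; apply/asboolP.
Qed.

Lemma word_classK x : word_class (repr x) = x.
Proof. exact: reprK. Qed.

Lemma word_repr u : word_eq (repr (word_class u)) u.
Proof. by apply/word_piP; rewrite /word_class reprK. Qed.

Definition syl_inv (a : syllable) : syllable :=
  let: existT i b := a in syl b^-1.

Definition word_inv (u : seq syllable) : seq syllable := rev (map syl_inv u).

Lemma word_inv_cat u v : word_inv (u ++ v) = word_inv v ++ word_inv u.
Proof. by rewrite /word_inv map_cat rev_cat. Qed.

Lemma word_inv_eq u v : word_eq u v -> word_eq (word_inv u) (word_inv v).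
Proof.
elim=> {u v}.
- by move=> u; exact: word_refl.
- by move=> u v _; exact: word_sym.
- by move=> u v w _ uv _; exact: word_trans.
- by move=> u u' v v' _ uu' _ vv'; rewrite !word_inv_cat; exact: word_cat.
- by move=> i; rewrite /word_inv /= /rev /= invg1; exact: word_one.
- by move=> i a b; rewrite /word_inv /= /rev /= invgM; exact: word_mul.
- move=> i a b; rewrite /word_inv /= /rev /=.
  exact/word_sym/(@word_comm i).
Qed.

Lemma word_invV u : word_eq (word_inv u ++ u) [::].
Proof.
elim: u => [|[i a] u IHu]; first exact: word_refl.
rewrite -cat1s word_inv_cat -catA.
apply: word_trans IHu; apply: word_cat (word_refl _) _.
rewrite catA -[X in word_eq _ X]cat0s; apply: word_cat (word_refl _).
apply: word_trans (word_mul _ _) _; rewrite mulVg; exact: word_one.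
Qed.

Lemma word_invK : involutive word_inv.
Proof.
move=> u; rewrite /word_inv map_rev revK -map_comp -[RHS]map_id.
by apply: eq_map => -[i a] /=; rewrite invgK.
Qed.

Definition cp_one : cyclic_product := word_class [::].
Definition cp_mul (x y : cyclic_product) : cyclic_product := word_class (repr x ++ repr y).
Definition cp_inv (x : cyclic_product) : cyclic_product := word_class (word_inv (repr x)).

Lemma cp_mulE u v : cp_mul (word_class u) (word_class v) = word_class (u ++ v).
Proof. by apply/word_piP; apply: word_cat; exact: word_repr. Qed.

Lemma cp_invE u : cp_inv (word_class u) = word_class (word_inv u).
Proof. by apply/word_piP; apply: word_inv_eq; exact: word_repr. Qed.

Lemma cp_mulA : associative cp_mul.
Proof.
by move=> x y z; rewrite -[x]word_classK -[y]word_classK -[z]word_classK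
  (cp_mulE (repr x)) (cp_mulE (repr y)) !cp_mulE catA.
Qed.

Lemma cp_mul1g : left_id cp_one cp_mul.
Proof. by move=> x; rewrite -[x]word_classK cp_mulE. Qed.

Lemma cp_mulg1 : right_id cp_one cp_mul.
Proof. by move=> x; rewrite -[x]word_classK cp_mulE cats0. Qed.

Lemma cp_mulVg : left_inverse cp_one cp_inv cp_mul.
Proof.
by move=> x; rewrite -[x]word_classK cp_invE cp_mulE; apply/word_piP; exact: word_invV.
Qed.

Lemma cp_mulgV : right_inverse cp_one cp_inv cp_mul.
Proof.
move=> x; rewrite -[x]word_classK cp_invE cp_mulE; apply/word_piP.
by rewrite -{1}[repr x]word_invK; exact: word_invV.
Qed.

HB.instance Definition _ := isGroup.Build cyclic_product
  cp_mulA cp_mul1g cp_mulg1 cp_mulVg cp_mulgV.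

Definition cp_emb (i : 'I_n) (a : G i) : cyclic_product := word_class [:: syl a].

Definition pair_subgroup (i : 'I_n) : set cyclic_product :=
  smallest (@is_subgroup cyclic_product)
    (range (@cp_emb i) `|` range (@cp_emb (ordS i))).

End CyclicProduct.

Arguments pair_subgroup {n} G i.

Section DavisComplex.
Variables (R : realType) (n : nat) (G : 'I_n -> groupType).
Local Notation C := (cyclic_product G).

Definition unit0 : {i01 R} := (0%:i01)%R.
Definition unit1 : {i01 R} := (1%:i01)%R.

Definition coset_vertex (k : C) (i : 'I_n) : set C := lcoset k (pair_subgroup G i).

(* [(g, i, (s, t))] is a point of the square at the corner
   [coset_vertex g i] of the polygon of [g].  The corner of the square at
   [(0, 0)] is the centre of the polygon, the one at [(1, 1)] is the vertex
   itself, and those at [(1, 0)] and [(0, 1)] are the midpoints of the polygon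
   edges leading to the vertices of index [i - 1] and [i + 1]. *)
Definition square_point : Type := C * 'I_n * ({i01 R} * {i01 R}).

(* [glue_spoke] assembles the [n] squares of a polygon; the other rules
   identify vertices given by the same coset and edges with the same
   endpoints: [glue_edge_next] is the half of the edge from vertex [i] to
   vertex [i + 1] that contains vertex [i], and [glue_edge_prev] the half that
   contains vertex [i + 1]. *)
Inductive glue : square_point -> square_point -> Prop :=
| glue_refl p : glue p p
| glue_sym p q : glue p q -> glue q p
| glue_trans p q r : glue p q -> glue q r -> glue p r
| glue_spoke g i t : glue (g, i, (unit0, t)) (g, ordS i, (t, unit0))
| glue_vertex g h i :
    coset_vertex g i = coset_vertex h i ->
    glue (g, i, (unit1, unit1)) (h, i, (unit1, unit1))
| glue_edge_next g h i s :
    coset_vertex g i = coset_vertex h i ->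
    coset_vertex g (ordS i) = coset_vertex h (ordS i) ->
    glue (g, i, (s, unit1)) (h, i, (s, unit1))
| glue_edge_prev g h i t :
    coset_vertex g i = coset_vertex h i ->
    coset_vertex g (ordS i) = coset_vertex h (ordS i) ->
    glue (g, ordS i, (unit1, t)) (h, ordS i, (unit1, t)).

Definition glueb : rel square_point := fun p q => `[< glue p q >].

Lemma glueb_refl : reflexive glueb.
Proof. by move=> p; apply/asboolP; exact: glue_refl. Qed.
Lemma glueb_sym : symmetric glueb.
Proof. by move=> p q; apply/asboolP/asboolP; exact: glue_sym. Qed.
Lemma glueb_trans : transitive glueb.
Proof.
by move=> q p r /asboolP pq /asboolP qr; apply/asboolP; exact: glue_trans qr.
Qed.

Canonical glue_equiv := EquivRel glueb glueb_refl glueb_sym glueb_trans.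

Definition davis := {eq_quot glue_equiv}.
HB.instance Definition _ := Choice.on davis.
HB.instance Definition _ := EqQuotient.on davis.

Definition davis_point (p : square_point) : davis := \pi_davis p.

Lemma davis_piP p q : davis_point p = davis_point q <-> glue p q.
Proof.
rewrite /davis_point; split => [/eqP|pq]; first by rewrite piE => /asboolP.
by apply/eqP; rewrite piE; apply/asboolP.
Qed.

Definition davis_vertex (k : C) (i : 'I_n) : davis :=
  davis_point (k, i, (unit1, unit1)).

(* The squares are unit Euclidean squares, and the metric of the complex is the
   associated length metric: an infimum over piecewise straight paths, each
   segment of which lies in one square. *)
Definition square_dist (a b : {i01 R} * {i01 R}) : R :=
  Num.sqrt ((a.1%:num - b.1%:num) ^+ 2 + (a.2%:num - b.2%:num) ^+ 2)%R.

Inductive path_length (x : davis) : davis -> R -> Prop :=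
| path_nil : path_length x x 0%R
| path_step l g i a b :
    path_length x (davis_point (g, i, a)) l ->
    path_length x (davis_point (g, i, b)) (l + square_dist a b)%R.

Definition davis_dist (x y : davis) : R := inf [set l | path_length x y l].

(* Left multiplication by [g]; it sends the polygon of [h] to that of [g * h],
   see [davis_lmulE]. *)
Definition square_lmul (g : C) (p : square_point) : square_point :=
  (g * p.1.1, p.1.2, p.2).

Definition davis_lmul (g : C) (x : davis) : davis := davis_point (square_lmul g (repr x)).

Lemma lcoset_mul (g k : C) (K : set C) : lcoset (g * k) K = lcoset g (lcoset k K).
Proof.
rewrite /lcoset image_comp; apply: eq_imagel => h _ /=.
by rewrite mulgA.
Qed.

Lemma coset_vertex_mul (g h k : C) i : coset_vertex h i = coset_vertex k i ->
  coset_vertex (g * h) i = coset_vertex (g * k) i.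
Proof. by rewrite /coset_vertex !lcoset_mul => ->. Qed.

Lemma glue_lmul g p q : glue p q -> glue (square_lmul g p) (square_lmul g q).
Proof.
elim=> {p q}.
- by move=> p; exact: glue_refl.
- by move=> p q _; exact: glue_sym.
- by move=> p q r _ pq _; exact: glue_trans.
- by move=> h i t; exact: glue_spoke.
- by move=> h k i hk; apply: glue_vertex; exact: coset_vertex_mul.
- by move=> h k i s hk hk'; apply: glue_edge_next; exact: coset_vertex_mul.
- by move=> h k i t hk hk'; apply: glue_edge_prev; exact: coset_vertex_mul.
Qed.

Lemma davis_lmulE g p : davis_lmul g (davis_point p) = davis_point (square_lmul g p).
Proof. by apply/davis_piP/glue_lmul/davis_piP; rewrite /davis_point reprK. Qed.

(* [designates A x] says that the subset [A] of the group denotes the vertex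
   [x] of the complex: a right translate of [A] is a left coset [k * H] with
   [H = pair_subgroup G i], and [x] is the vertex [kH].  When [A] is itself
   such a coset, this is the vertex that it is.  The right translate is needed
   to let automorphisms act through [phi(kH) = phi(k) phi(H)]: in general
   [phi(H)] is only a conjugate [g * H' * g^-1] of a standard subgroup [H'],
   so that [phi(k) phi(H)] is a left coset of that conjugate and the
   corresponding left coset of [H'] is [phi(k) phi(H) * g]. For instance, for
   the inner automorphism of [g], [phi(k) phi(H) = g * k * H * g^-1] denotes
   the vertex [g * k * H]. *)
Definition designates (A : set C) (x : davis) : Prop :=
  exists g k i, rtranslate A g = coset_vertex k i /\ x = davis_vertex k i.

End DavisComplex.

(* Main.v *)
(* Write C for the cyclic product. Killing the factors outside a set S of indices
   gives a retraction of C onto the parabolic subgroup spanned by S. For every j, C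
   is the amalgam of G_j x L_j and of the subgroup spanned by the indices other
   than j over L_j = G_(j-1) * G_(j+1), and it acts on the corresponding tree.
   An element that is conjugate into no star subgroup St_j = G_j x L_j is
   loxodromic in one of these trees, and its centralizer is so small that two
   commuting subgroups, one nontrivial and the other nonabelian, lie in a common
   conjugate of a star subgroup. Hence an automorphism phi permutes the
   conjugates of the star subgroups, and then those of the G_i. In the resulting
   cyclic sequence of conjugates, consecutive ones can be conjugated simultaneously
   into standard position; as the product of the transition elements around
   the cycle is 1, applying the retractions to it yields a single gamma and a
   symmetry sigma of the n-cycle with phi(G_i) = gamma G_(sigma i) gamma^-1 for
   all i. Both are unique, and phi maps the polygon of g to that of
   phi(g) gamma, relabelled by sigma. *)

Require Import Defs.
From mathcomp Require Import all_boot all_order all_algebra.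
From mathcomp Require Import all_classical all_reals.
From mathcomp Require Import interval_inference zify.

Set Implicit Arguments.
Unset Strict Implicit.
Unset Printing Implicit Defensive.

Local Open Scope group_scope.

(** * Retractions onto parabolic subgroups *)

(** No tree is built: of the tree of [j] only the displacement [len j] of one vertex and the Gromov
    product are kept, both read off a normal form, so that statements about axes become inequalities
    in [nat]. Retractions do not increase [len j], which brings conjugators and centralizing
    elements back into parabolic subgroups. For n >= 5 the cycle has no triangle and no square: the
    neighbours of [j] do not commute, so L_j is nonabelian, and the stars of j-1 and j+1 share only
    [j], which confines centralizers and makes gamma unique. The commuting pair used is phi(G_i),
    phi(L_i). It yields inclusions only; phi^-1 turns them into equalities. The passage from stars
    to the G_i rests on L_m not being a product of two commuting nontrivial subgroups. *)

Section Subgroups.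
Variable A : groupType.
Implicit Types x y g h : A.

Lemma commuteJ x y g : commute x y -> commute (x ^ g) (y ^ g).
Proof. by rewrite /commute -!conjMg => ->. Qed.

Lemma commuteMl x y z : commute x z -> commute y z -> commute (x * y) z.
Proof. by move=> *; apply/commute_sym/commuteM; apply/commute_sym. Qed.

Lemma conjg_comm x g : commute x g -> x ^ g = x.
Proof. by rewrite /commute conjgE => ->; rewrite mulKg. Qed.

Lemma eq_conj_comm x g h : x ^ g = x ^ h -> commute x (g * h^-1).
Proof.
move=> e; have : x ^ (g * h^-1) = x by rewrite conjgM e conjgK.
by rewrite conjgE => /(canRL (mulVKg _)).
Qed.

End Subgroups.

Section CyclicProduct.
Variables (n : nat) (n_ge5 : (5 <= n)%N) (G : 'I_n -> groupType).
Local Notation C := (cyclic_product G).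
Local Notation syllable := (syllable G).
Implicit Types (i j k : 'I_n) (S T U : pred 'I_n) (g h x y : C).

Definition adj i j := (j == ordS i) || (i == ordS j).

Lemma val_ordS i : ordS i = (if i.+1 < n then i.+1 else 0)%N :> nat.
Proof.
rewrite /=; case: ltnP => [/modn_small //|].
move=> ni; have lin := ltn_ord i.
by rewrite (_ : i.+1 = n) ?modnn//; lia.
Qed.

Lemma adjE i j : adj i j =
  [|| j == i.+1 :> nat, i == j.+1 :> nat, (j == 0 :> nat) && (i.+1 == n)
    | (i == 0 :> nat) && (j.+1 == n)]%N.
Proof.
have E k l : (k == ordS l) =
    (k == l.+1 :> nat)%N || (k == 0 :> nat)%N && (l.+1 == n).
  rewrite -val_eqE -[val (ordS l)]/(nat_of_ord _) -[val k]/(nat_of_ord _) val_ordS.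
  by have := ltn_ord k; have := ltn_ord l; case: (ltnP l.+1 n); lia.
by rewrite /adj !E; lia.
Qed.

Lemma adj_irr i : adj i i = false.
Proof. by rewrite adjE; have := ltn_ord i; lia. Qed.

Lemma adj_trifree i j k : adj i j -> adj j k -> adj i k -> False.
Proof.
by rewrite !adjE; have := ltn_ord i; have := ltn_ord j; have := ltn_ord k; lia.
Qed.

(** For n = 4 two opposite indices have two common neighbours, so the bound on [n] is sharp here. *)
Lemma adj_sqfree i j k l :
  adj i j -> adj j k -> adj k l -> adj l i -> i != k -> j = l.
Proof.
rewrite !adjE -val_eqE /= => ij jk kl li ik; apply/val_inj => /=.
move: ij jk kl li ik; have := ltn_ord i; have := ltn_ord j; have := ltn_ord k; have := ltn_ord l; lia.
Qed.

Lemma adj_sym i j : adj i j = adj j i.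
Proof. by rewrite /adj orbC. Qed.

Definition link j : pred 'I_n := [pred i | adj j i].
Definition star j : pred 'I_n := [pred i | (i == j) || adj j i].

Lemma word_class_cons (s : syllable) u :
  word_class (s :: u) = (word_class [:: s] : C) * word_class u.
Proof. by rewrite -[RHS]/(cp_mul _ _) cp_mulE. Qed.

Lemma cp_ind (P : C -> Prop) :
  P 1 -> (forall i (a : G i) g, P g -> P (cp_emb a * g)) -> forall g, P g.
Proof.
move=> P1 PM g; rewrite -[g]word_classK; elim: (repr g) => [|[i a] u IHu].
  exact: P1.
by rewrite word_class_cons; exact: PM.
Qed.

Lemma cp_embM i (a b : G i) : cp_emb (a * b) = cp_emb a * cp_emb b.
Proof.
rewrite -[RHS]/(cp_mul _ _) cp_mulE; apply/word_piP/word_sym; exact: word_mul.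
Qed.

Lemma cp_emb1 i : cp_emb (1 : G i) = 1.
Proof. exact/word_piP/word_one. Qed.

Lemma cp_emb_comm i j (a : G i) (b : G j) :
  adj i j -> commute (cp_emb a) (cp_emb b).
Proof.
wlog e : i j a b / j == ordS i => [hw /orP[e|e]|_].
- by apply: hw; rewrite /adj e.
- by apply/commute_sym/hw; rewrite /adj e.
move: b; rewrite (eqP e) => b.
rewrite /commute -[LHS]/(cp_mul _ _) -[RHS]/(cp_mul _ _) !cp_mulE.
exact/word_piP/word_comm.
Qed.

(* Words act on a set as soon as syllables do, compatibly with the relations;
   [Q] allows for the relations to hold on a stable subset only. *)
Lemma word_eq_act (X : Type) (Q : X -> Prop) (f : syllable -> X -> X) :
  (forall s z, Q z -> Q (f s z)) ->
  (forall i z, Q z -> f (syl (1 : G i)) z = z) ->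
  (forall i (a b : G i) z, Q z -> f (syl a) (f (syl b) z) = f (syl (a * b)) z) ->
  (forall i j (a : G i) (b : G j) z, adj i j -> Q z ->
    f (syl a) (f (syl b) z) = f (syl b) (f (syl a) z)) ->
  forall u v z, word_eq u v -> Q z -> foldr f z u = foldr f z v.
Proof.
move=> fQ f1 fM fC u v z uv.
have foldQ w z' : Q z' -> Q (foldr f z' w).
  by move=> Qz; elim: w => //= s w; exact: fQ.
elim: uv z => {u v} //=.
- by move=> u v _ e z Qz; rewrite e.
- by move=> u v w _ e1 _ e2 z Qz; rewrite e1 ?e2.
- move=> u u' v v' _ e1 _ e2 z Qz; rewrite !foldr_cat (e2 z) // e1 //.
  exact: foldQ.
- by move=> i a b z Qz; apply: fC; rewrite // /adj eqxx.
Qed.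

(** Words act on [G i] by left multiplication through their syllables of index [i]; the word of [a]
    sends 1 to [a]. *)
Lemma cp_emb_neq1 i (a : G i) : a <> 1 -> cp_emb a <> 1.
Proof.
move=> a1 /word_piP e.
pose f (s : syllable) (z : G i) : G i :=
  if eqVneq (tag s) i is EqNotNeq e
  then eq_rect _ (fun k => G k : Type) (tagged s) _ e * z else z.
have fE (b : G i) z : f (syl b) z = b * z.
  by rewrite /f /=; case: eqVneq => [e'|/eqP//]; rewrite (eq_irrelevance e' erefl).
have fN k (b : G k) z : k != i -> f (syl b) z = z.
  by rewrite /f /=; case: eqVneq.
have := @word_eq_act _ (fun _ => True) f _ _ _ _ _ _ 1 e I => /=.
rewrite fE mulg1 => h; apply: a1; apply: h => // {a e}.
- move=> k z _; have [e|?] := eqVneq k i; last by rewrite fN.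
  by subst k; rewrite fE mul1g.
- move=> k a b z _; have [e|?] := eqVneq k i; last by rewrite !fN.
  by subst k; rewrite !fE mulgA.
- move=> j k a b z jk _; have [e|?] := eqVneq j i; last by rewrite ![f (syl a) _]fN.
  have [e'|?] := eqVneq k i; last by rewrite ![f (syl b) _]fN.
  by subst j k; rewrite adj_irr in jk.
Qed.

Definition ret S g : C := word_class [seq s <- repr g | S (tag s)].

Lemma ret_word S u : ret S (word_class u) = word_class [seq s <- u | S (tag s)].
Proof.
have ret_eq v w : word_eq v w ->
    word_eq [seq s : syllable <- v | S (tag s)] [seq s <- w | S (tag s)].
  elim=> {v w} /=.
  - by move=> v; exact: word_refl.
  - by move=> v w _; exact: word_sym.
  - by move=> v w z _ vw _; exact: word_trans.
  - by move=> v v' w w' _ vw _ vw'; rewrite !filter_cat; exact: word_cat.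
  - by move=> i; case: (S i); [exact: word_one|exact: word_refl].
  - by move=> i a b; case: (S i); [exact: word_mul|exact: word_refl].
  - move=> i a b; case: (S i); case: (S (ordS i)); try exact: word_refl.
    exact: word_comm.
by apply/word_piP/ret_eq/word_repr.
Qed.

Lemma ret_emb S i (a : G i) : ret S (cp_emb a) = if S i then cp_emb a else 1.
Proof. by rewrite ret_word /=; case: ifP. Qed.

Lemma retM S : {morph ret S : g h / g * h}.
Proof.
move=> g h; rewrite -[g]word_classK -[h]word_classK.
rewrite -[X in ret S X]/(cp_mul _ _) -[RHS]/(cp_mul _ _).
by rewrite cp_mulE !ret_word filter_cat cp_mulE.
Qed.

Lemma ret1 S : ret S 1 = 1.
Proof. exact: ret_word. Qed.

Lemma retV S g : ret S g^-1 = (ret S g)^-1.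
Proof. by apply: (mulgI (ret S g)); rewrite -retM !mulgV ret1. Qed.

Lemma retJ S g h : ret S (g ^ h) = ret S g ^ ret S h.
Proof. by rewrite !conjgE !retM retV. Qed.

Lemma ret_ret S T g : ret S (ret T g) = ret (predI S T) g.
Proof.
by rewrite -[g]word_classK !ret_word -filter_predI.
Qed.

Lemma eq_ret S T : S =1 T -> ret S =1 ret T.
Proof.
by move=> e g; rewrite /ret; congr word_class; apply: eq_filter => s; exact: e.
Qed.

Lemma ret_sub S T g : subpred S T -> ret S (ret T g) = ret S g.
Proof.
move=> ST; rewrite ret_ret; apply: eq_ret => i /=.
by case Si: (S i) => //=; rewrite ST.
Qed.

Lemma ret_subC S T g : subpred S T -> ret T (ret S g) = ret S g.
Proof.
move=> ST; rewrite ret_ret; apply: eq_ret => i /=.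
by case Si: (S i) => /=; rewrite ?andbF // ST.
Qed.

Lemma ret_pred0 g : ret pred0 g = 1.
Proof. by rewrite /ret filter_pred0. Qed.

Lemma ret_disj S T g : (forall i, S i -> T i -> False) -> ret S (ret T g) = 1.
Proof.
move=> ST; rewrite ret_ret (@eq_ret _ pred0) ?ret_pred0// => i /=.
by apply/negP => /andP[/ST].
Qed.

(* The parabolic subgroup spanned by [S], as the fixed points of the retraction
   onto it. *)
Definition par S : set C := [set g | ret S g = g].

Lemma par_ret S g : par S (ret S g).
Proof. exact: ret_sub. Qed.

Lemma par_emb S i (a : G i) : S i -> par S (cp_emb a).
Proof. by move=> Si; rewrite /par/= ret_emb Si. Qed.

Lemma par1 S : par S 1. Proof. exact: ret1. Qed.

Lemma parM S g h : par S g -> par S h -> par S (g * h).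
Proof. by move=> Sg Sh; rewrite /par/= retM Sg Sh. Qed.

Lemma parV S g : par S g -> par S g^-1.
Proof. by move=> Sg; rewrite /par/= retV Sg. Qed.

Lemma parVE S g : par S g^-1 <-> par S g.
Proof. by split=> [/parV|/parV //]; rewrite invgK. Qed.

Lemma parJ S g h : par S g -> par S h -> par S (g ^ h).
Proof. by move=> Sg Sh; rewrite /par/= retJ Sg Sh. Qed.

Lemma parJE S g h : par S h -> par S (g ^ h) <-> par S g.
Proof.
move=> Sh; split=> [/parJ/(_ (parV Sh))|/parJ]; last exact.
by rewrite conjgK.
Qed.

Lemma par_subgroup S : is_subgroup (par S).
Proof. by split; [exact: par1|exact: parM|exact: parV]. Qed.

Lemma par_sub S T g : subpred S T -> par S g -> par T g.
Proof. by move=> ST Sg; rewrite /par/= -Sg ret_subC. Qed.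

(** Retractions compose to the retraction onto the common indices, so parabolic subgroups meet in
    parabolic subgroups. *)
Lemma par_and S T U g : (forall i, S i -> T i -> U i) ->
  par S g -> par T g -> par U g.
Proof.
move=> STU Sg Tg; apply: (@par_sub (predI S T)) => [i /andP[]//|]; first exact: STU.
by rewrite /par/= -ret_ret Tg.
Qed.

Lemma par_eq1 S g : par S g -> (forall i, S i -> False) -> g = 1.
Proof.
by move=> <- S0; rewrite (@eq_ret _ pred0) ?ret_pred0// => i; apply/negP => /S0.
Qed.

Lemma par_and1 S T g : (forall i, S i -> T i -> False) -> par S g -> par T g -> g = 1.
Proof.
by move=> ST Sg Tg; apply: (@par_eq1 pred0) => //; apply: par_and Sg Tg => i Si /ST-/(_ Si).
Qed.

Lemma ret_par1 S T g : par T g -> (forall i, S i -> T i -> False) -> ret S g = 1.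
Proof. by move=> <- ST; exact: ret_disj. Qed.

Lemma ret_par S T U g : par T g -> (forall i, S i -> T i -> U i) -> par U (ret S g).
Proof.
move=> <- STU; apply: (@par_sub (predI S T)) => [i /andP[]//|]; first exact: STU.
by rewrite ret_ret; exact: par_ret.
Qed.

Lemma par_comm S T g h : (forall i j, S i -> T j -> adj i j) ->
  par S g -> par T h -> commute g h.
Proof.
move=> ST <- <-; elim/cp_ind: g => [|i a g IHg].
  by rewrite ret1; apply/commute_sym/commute1.
rewrite retM; apply: commuteMl IHg; rewrite ret_emb; case: ifPn => [Si|_]; last first.
  by apply/commute_sym/commute1.
elim/cp_ind: h => [|j b h IHh]; first by rewrite ret1; exact: commute1.
rewrite retM; apply: commuteM => //; rewrite ret_emb; case: ifPn => [Tj|_].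
  exact/cp_emb_comm/ST.
exact: commute1.
Qed.

Lemma ret_split S T U g : (forall i j, S i -> T j -> adj i j) ->
  (forall i, U i = S i || T i) -> ret U g = ret S g * ret T g.
Proof.
move=> ST UE; elim/cp_ind: g => [|i a g IHg]; first by rewrite !ret1 mulg1.
rewrite !retM IHg !ret_emb UE; case Si: (S i); case Ti: (T i) => //=.
- by have := ST i i Si Ti; rewrite adj_irr.
- by rewrite mul1g mulgA.
- rewrite mul1g !mulgA; congr (_ * _).
  apply: (@par_comm T S); last exact: par_ret; last exact: par_emb.
  by move=> j k Tj Sk; rewrite adj_sym ST.
- by rewrite !mul1g.
Qed.

Lemma par_gen S (K : set C) : is_subgroup K ->
  (forall i (a : G i), S i -> K (cp_emb a)) -> forall g, par S g -> K g.
Proof.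
move=> [K1 KM _] KS g <-; elim/cp_ind: g => [|i a g IHg]; first by rewrite ret1.
rewrite retM; apply: KM => //; rewrite ret_emb.
by case: ifPn => [|//]; exact: KS.
Qed.

Lemma pair_subgroupE i : pair_subgroup G i = par [pred k | (k == i) || (k == ordS i)].
Proof.
apply/seteqP; split=> g.
  move/(_ (par _)) => gen; apply: gen; split; first exact: par_subgroup.
  by move=> _ [[a _ <-]|[a _ <-]]; apply: par_emb; rewrite /= eqxx ?orbT.
move=> Sg K [Ksub KS]; apply: (par_gen Ksub) Sg => j a /orP[]/eqP e; subst j.
  by apply: KS; left; exists a.
by apply: KS; right; exists a.
Qed.

Lemma star_split j g : ret (star j) g = ret (pred1 j) g * ret (link j) g.
Proof. by apply: ret_split => // i k /= /eqP ->. Qed.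

Lemma par_star_split j g : par (star j) g -> g = ret (pred1 j) g * ret (link j) g.
Proof. by move=> e; rewrite -star_split. Qed.


End CyclicProduct.

(** * Displacement lengths in trees *)

(* [len] is the displacement of a base point in a tree and [gpr] is twice the
   Gromov product; a loxodromic element is cyclically reduced, that is, the base
   point lies on its axis. *)
Section TreeLength.
Variables (A : groupType) (len : A -> nat) (gpr : A -> A -> nat).
Hypothesis len_gpr :
  forall g k h, g * k = h -> (len k + gpr g h = len g + len h)%N.
Hypothesis len1 : len 1 = 0%N.
Hypothesis gpr_ultra : forall g h k, (minn (gpr g h) (gpr h k) <= gpr g k)%N.
Implicit Types x y z g h : A.

Lemma lenV g : len g^-1 = len g.
Proof.
have e1 : (len g + gpr g^-1 1 = len g^-1 + len 1)%N := len_gpr (mulVg g).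
have e2 : (len g^-1 + gpr g 1 = len g + len 1)%N := len_gpr (mulgV g).
lia.
Qed.

Lemma lenM_gpr g h : (len (g * h) + gpr g^-1 h = len g + len h)%N.
Proof. by rewrite -(lenV g); exact: len_gpr (mulKg g h). Qed.

Lemma lenVM_gpr g h : (len (g^-1 * h) + gpr g h = len g + len h)%N.
Proof. exact: len_gpr (mulVKg g h). Qed.

Lemma lenM g h : (len (g * h) <= len g + len h)%N.
Proof. by have := lenM_gpr g h; lia. Qed.

Lemma len_fourpoint x y z t : (len (x^-1 * y) + len (z^-1 * t) <=
  maxn (len (x^-1 * z) + len (y^-1 * t)) (len (x^-1 * t) + len (y^-1 * z)))%N.
Proof.
have base a b c : (len a + len (b^-1 * c) <=
    maxn (len b + len (a^-1 * c)) (len c + len (a^-1 * b)))%N.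
  have e : len (b^-1 * a) = len (a^-1 * b) by rewrite -lenV invgM invgK.
  have := gpr_ultra b a c; have := lenVM_gpr b a; have := lenVM_gpr b c.
  have := lenVM_gpr a c; rewrite e; lia.
have := base (x^-1 * y) (x^-1 * z) (x^-1 * t).
by rewrite !invgM !invgK !mulgA !mulgK.
Qed.

Definition lox x := (0 < len x)%N /\ len (x * x) = (len x).*2.

(** A path that does not backtrack at its corners is geodesic: [x] and [x ^+ m.+1] start together,
    [x^-1] and [x] do not, so by [gpr_ultra] neither do [x^-1] and [x ^+ m.+1]. *)
Lemma lox_expg x m : lox x -> len (x ^+ m) = (m * len x)%N.
Proof.
move=> [x0 xx].
suff [] : len (x ^+ m) = (m * len x)%N /\ len (x ^+ m.+1) = (m.+1 * len x)%N by [].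
elim: m => [|m [IHm IHm1]]; first by rewrite expg0 expg1 len1; lia.
split=> //; have /esym e : x^-1 * x ^+ m.+1 = x ^+ m by rewrite expgS mulKg.
have e1 := lenM_gpr x x; have e2 := lenM_gpr x (x ^+ m.+1).
have e3 : (len (x ^+ m) + gpr (x ^+ m.+1) x = len (x ^+ m.+1) + len x)%N.
  by rewrite e -[len (_ * _)]lenV invgM invgK; exact: lenVM_gpr.
have e4 := gpr_ultra x^-1 (x ^+ m.+1) x.
have -> : len (x ^+ m.+2) = len (x * x ^+ m.+1) by rewrite expgS.
lia.
Qed.

(** The base point is the midpoint of its images under [x ^+ m] and the inverse; the two bounds
    force its image under [y] to be that midpoint too. *)
Lemma lox_comm_len0 x y m : lox x -> commute x y ->
  (len (y * x ^+ m) <= m * len x)%N -> (len (y^-1 * x ^+ m) <= m * len x)%N ->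
  len y = 0%N.
Proof.
move=> lx xy u v.
have := len_fourpoint 1 y (x ^+ m)^-1 (x ^+ m).
have e : len (y^-1 * (x ^+ m)^-1) = len (y * x ^+ m).
  rewrite -lenV invgM !invgK.
  by congr len; apply/commute_sym/commuteX/commute_sym.
rewrite e !invg1 !mul1g invgK lenV -expgnDr !lox_expg//; lia.
Qed.

(** A shift of the axis by s is gained in one length and lost in the other. The bound on [len y]
    decides which term of the four-point maximum counts. *)
Lemma lox_comm_sum x y m : lox x -> commute x y -> (len y < m)%N ->
  (len (y * x ^+ m) + len (y^-1 * x ^+ m) <= (m * len x).*2)%N.
Proof.
move=> lx xy ym; have := len_fourpoint 1 (y * x ^+ m) y (x ^+ m).
have -> : (y * x ^+ m)^-1 * x ^+ m = y^-1.
  by rewrite (commuteX m (commute_sym xy)) invgM mulgVK.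
rewrite invgM mulgVK invg1 !mul1g !lenV !lox_expg//.
by case: lx => x0 _; nia.
Qed.

Lemma lox_comm_ge x y : lox x -> commute x y ->
  (forall m, m * len x <= len (y * x ^+ m))%N ->
  (forall m, m * len x <= len (y^-1 * x ^+ m))%N -> len y = 0%N.
Proof.
move=> lx xy u v; have := lox_comm_sum lx xy (ltnSn _).
move: (u (len y).+1) (v (len y).+1) => {}u {}v uv.
by apply: (lox_comm_len0 (m := (len y).+1) lx xy); lia.
Qed.

(* The elements commuting with a loxodromic one translate its axis, so that their
   commutators fix it pointwise. *)
Lemma lox_comm_commg x y z : lox x -> commute x y -> commute x z ->
  len [~ y, z] = 0%N.
Proof.
move=> lx; have half a b m : commute x a -> commute x b ->
    (len a < m)%N -> (len b < m)%N ->
    (len ([~ a, b] * x ^+ (m + m + (m + m))) <= (m + m + (m + m)) * len x)%N.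
  move=> xa xb am bm; set X := x ^+ m.
  have Xa c : commute x c -> commute X c.
    by move=> xc; apply/commute_sym/commuteX/commute_sym.
  (* Four times [m], so that each letter of the commutator takes one factor [x ^+ m]; the shifts of
     [a] and [a^-1], and those of [b] and [b^-1], then compensate. *)
  have -> : [~ a, b] * x ^+ (m + m + (m + m)) =
      (a^-1 * X) * (b^-1 * X) * ((a * X) * (b * X)).
    have aX := Xa _ xa; have bX := Xa _ xb.
    have aVX := Xa _ (commuteV xa); have bVX := Xa _ (commuteV xb).
    have push u v : commute X v -> u * X * (v * X) = u * v * (X * X).
      by move=> Xv; rewrite !mulgA; congr (_ * X); rewrite -!mulgA Xv.
    rewrite !push// !expgnDr -/X commgEl conjgE.
    have XX : commute (X * X) (a * b).
      by apply: commuteM; apply: commuteMl.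
    transitivity (a^-1 * b^-1 * (a * b * (X * X)) * (X * X)).
      by rewrite !mulgA.
    by rewrite -[in LHS]XX !mulgA.
  have := lox_comm_sum lx xa am; have := lox_comm_sum lx xb bm.
  have : (len (a^-1 * X * (b^-1 * X) * (a * X * (b * X))) <=
      len (a^-1 * X) + len (b^-1 * X) + (len (a * X) + len (b * X)))%N.
    exact: leq_trans (lenM _ _) (leq_add (lenM _ _) (lenM _ _)).
  rewrite -/X; nia.
move=> xy xz; set m := (maxn (len y) (len z)).+1.
apply: (lox_comm_len0 (m := m + m + (m + m)) lx).
- by rewrite /commg /conjg; do !apply: commuteM => //; apply: commuteV.
- by apply: half => //; rewrite /m; lia.
- by rewrite invgR; apply: half => //; rewrite /m; lia.
Qed.

Lemma lox_unbounded x g K : lox x -> exists m, (K < len ((x ^ g) ^+ m))%N.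
Proof.
move=> lx; pose m := (K + (len g).*2).+1; exists m.
have -> : (x ^ g) ^+ m = (x ^+ m) ^ g by rewrite conjXg.
have e : g * ((x ^+ m) ^ g * g^-1) = x ^+ m.
  by rewrite conjgE mulgA mulVKg mulgK.
have : (len (x ^+ m) <= len g + (len ((x ^+ m) ^ g) + len g))%N.
  rewrite -{1}e; apply: leq_trans (lenM _ _) _; rewrite leq_add2l.
  by apply: leq_trans (lenM _ _) _; rewrite lenV.
by rewrite lox_expg//; case: lx => x0 _; rewrite /m; nia.
Qed.

End TreeLength.

(** * The tree of the splitting at an index *)

Section Cosets.
Variable A : groupType.
Implicit Types (K : set A) (g h : A).

Lemma lcosetM K g h : lcoset (g * h) K = lcoset g (lcoset h K).
Proof.
by rewrite /lcoset image_comp; apply: eq_imagel => k _ /=; rewrite mulgA.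
Qed.

Lemma lcoset1 K : lcoset 1 K = K.
Proof.
by apply/seteqP; split=> [_ [k Kk <-]|k Kk]; [rewrite mul1g|exists k; rewrite ?mul1g].
Qed.

Lemma lcosetK K g : lcoset g^-1 (lcoset g K) = K.
Proof. by rewrite -lcosetM mulVg lcoset1. Qed.

Lemma lcoset_inj g : injective (fun K => lcoset g K).
Proof. exact: can_inj (fun K => lcosetK K g). Qed.

Lemma lcoset_eq K g h : is_subgroup K -> lcoset g K = lcoset h K <-> K (g^-1 * h).
Proof.
move=> [K1 KM KV]; split=> [e|Kgh].
  have : lcoset h K h by exists 1; rewrite ?mulg1.
  by rewrite -e => -[k Kk <-]; rewrite mulKg.
apply/seteqP; split=> _ [k Kk <-].
  exists (h^-1 * g * k); last by rewrite -!mulgA !mulVKg.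
  by apply: KM => //; rewrite -[h^-1 * g]invgK invgM invgK; exact: KV.
by exists (g^-1 * h * k); [exact: KM|rewrite -!mulgA !mulVKg].
Qed.

End Cosets.

Section Tree.
Variables (n : nat) (n_ge5 : (5 <= n)%N) (G : 'I_n -> groupType) (j : 'I_n).
Local Notation C := (cyclic_product G).
Local Notation syllable := (syllable G).
Implicit Types (g h x y p a : C).

Local Notation vtx := (par (G := G) (pred1 j)).
Local Notation cpl := (par (G := G) (predC1 j)).
Local Notation base := (par (G := G) (link j)).

(* C is the semidirect product, by the subgroup spanned by the indices other than
   [j], of the free product of the conjugates of [G j] under that subgroup. These
   conjugates are indexed by the cosets of [base]; the pair of a coset [p * base]
   and of [a] in [G j] stands for [p * a * p^-1], and a reduced sequence of such
   pairs is a normal form for the free product. *)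
Definition letter : Type := set C * C.
Implicit Types s t : seq letter.

Definition cons_base (c : C) s : seq letter := if c == 1 then s else (base, c) :: s.
Definition head_coef s : C :=
  if s is l :: _ then if l.1 == base then l.2 else 1 else 1.
Definition tail_base s : seq letter :=
  if s is l :: t then if l.1 == base then t else s else s.
(** The default coefficient 1 lets one formula insert, merge or cancel a first letter. *)
Definition mul_head (a : C) s := cons_base (a * head_coef s) (tail_base s).
Definition shift (p : C) s : seq letter := [seq (lcoset p l.1, l.2) | l <- s].
Definition step (z : syllable) : seq letter -> seq letter :=
  if tag z == j then mul_head (word_class [:: z]) else shift (word_class [:: z]).

Definition reduced s :=
  all (fun l => l.2 != 1) s && sorted (fun l l' => l.1 != l'.1) s.
Definition nonbase s := if s is l :: _ then l.1 != base else true.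

Lemma cons_baseK s : reduced s -> cons_base (head_coef s) (tail_base s) = s.
Proof.
case: s => [|[w a] s]; first by rewrite /cons_base /= eqxx.
rewrite /reduced /= => /andP[/andP[a1 _] _].
case: eqVneq => [->|_] /=; last by rewrite /cons_base eqxx.
by rewrite /cons_base (negbTE a1).
Qed.

Lemma tail_base_red s : reduced s -> reduced (tail_base s) && nonbase (tail_base s).
Proof.
case: s => [//|[w a] s] rs /=; case: eqVneq => [e|ne]; last by rewrite rs.
move: rs; rewrite /reduced /= e => /andP[/andP[_ ->]].
by case: s => //= l s /andP[nl ->]; rewrite eq_sym nl.
Qed.

Lemma cons_base_red c s : reduced s -> nonbase s -> reduced (cons_base c s).
Proof.
rewrite /cons_base; case: eqVneq => // c1; rewrite /reduced /= c1 => /andP[->].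
by case: s => //= l s ->; rewrite eq_sym andbT.
Qed.

Lemma head_coef_cons c s : nonbase s -> head_coef (cons_base c s) = c.
Proof.
rewrite /cons_base; case: eqVneq => [->|_] /=; last by rewrite eqxx.
by case: s => //= l s /negbTE ->.
Qed.

Lemma tail_base_cons c s : nonbase s -> tail_base (cons_base c s) = s.
Proof.
rewrite /cons_base; case: eqVneq => [_|_] /=; last by rewrite eqxx.
by case: s => //= l s /negbTE ->.
Qed.

Lemma mul_head_red a s : reduced s -> reduced (mul_head a s).
Proof. by move=> /tail_base_red/andP[*]; exact: cons_base_red. Qed.

Lemma mul_head1 s : reduced s -> mul_head 1 s = s.
Proof. by move=> rs; rewrite /mul_head mul1g cons_baseK. Qed.

Lemma mul_headM a b s : reduced s -> mul_head a (mul_head b s) = mul_head (a * b) s.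
Proof.
move=> /tail_base_red/andP[_ ns].
by rewrite /mul_head head_coef_cons// tail_base_cons// mulgA.
Qed.

Lemma shift_red p s : reduced s -> reduced (shift p s).
Proof.
rewrite /reduced /shift all_map => /andP[-> /=]; case: s => //= l s.
elim: s l => //= l' s IHs l /andP[ll' /IHs ->]; rewrite andbT.
by apply: contra ll' => /eqP/lcoset_inj ->.
Qed.

Lemma shiftM p q s : shift p (shift q s) = shift (p * q) s.
Proof. by rewrite /shift -map_comp; apply: eq_map => l /=; rewrite lcosetM. Qed.

Lemma shift1 s : shift 1 s = s.
Proof. by rewrite -[RHS]map_id; apply: eq_map => -[w a] /=; rewrite lcoset1. Qed.

Lemma base_subgroup : is_subgroup base. Proof. exact: par_subgroup. Qed.

Lemma lcoset_base p : lcoset p base = base <-> base p.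
Proof.
rewrite -{2}(lcoset1 base) lcoset_eq; last exact: base_subgroup.
by rewrite mulg1 parVE.
Qed.

Lemma lcoset_base_eq p w : base p -> (lcoset p w == base) = (w == base).
Proof.
by move=> /lcoset_base bp; rewrite -{1}bp; apply/eqP/eqP => [/lcoset_inj|->].
Qed.

Lemma shift_mul_head p a s : base p -> shift p (mul_head a s) = mul_head a (shift p s).
Proof.
move=> bp; have e := lcoset_base_eq _ bp.
have sc c t : shift p (cons_base c t) = cons_base c (shift p t).
  by rewrite /cons_base; case: ifP => //= _; rewrite ((lcoset_base p).2 bp).
by rewrite /mul_head sc; case: s => //= -[w b] t /=; rewrite e; case: ifP.
Qed.

Lemma shift_nonbase p s : base p -> nonbase (shift p s) = nonbase s.
Proof. by move=> bp; case: s => //= l s; rewrite lcoset_base_eq. Qed.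

Lemma step_red z s : reduced s -> reduced (step z s).
Proof. by rewrite /step; case: ifP => _; [exact: mul_head_red|exact: shift_red]. Qed.

Definition tact g s := foldr step s (repr g).

(** Only the commutation of [G j] with a neighbouring factor mixes the two kinds of steps, and it
    holds because that factor fixes the coset [base]. *)
Lemma tact_word u s : reduced s -> tact (word_class u) s = foldr step s u.
Proof.
apply: (word_eq_act (Q := reduced)); last exact: word_repr.
- exact: step_red.
- move=> i t rt; rewrite /step /= -[word_class _]/(cp_emb _) cp_emb1.
  by case: ifP => _; rewrite ?mul_head1 ?shift1.
- move=> i a b t rt; rewrite /step /= -!/(cp_emb _) cp_embM.
  by case: ifP => _; rewrite ?mul_headM ?shiftM.
- move=> i k a b t ik rt; rewrite /step /= -!/(cp_emb _).
  have [ei|ni] := eqVneq i j; have [ek|nk] := eqVneq k j.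
  + by rewrite ei ek adj_irr in ik.
  + rewrite shift_mul_head//; by apply: par_emb; rewrite -ei.
  + rewrite shift_mul_head//; by apply: par_emb; rewrite -ek; move: ik; rewrite adj_sym.
  + by rewrite !shiftM (cp_emb_comm a b ik).
Qed.

Lemma tact_red g s : reduced s -> reduced (tact g s).
Proof. by move=> rs; rewrite /tact; elim: (repr g) => //= z u; exact: step_red. Qed.

Lemma tactM g h s : reduced s -> tact (g * h) s = tact g (tact h s).
Proof.
move=> rs; rewrite -[g]word_classK -[h]word_classK -[X in tact X]/(cp_mul _ _).
rewrite cp_mulE !tact_word ?foldr_cat//; exact: tact_red.
Qed.

Lemma tact1 s : reduced s -> tact 1 s = s.
Proof. by move=> rs; rewrite -[1]/(word_class [::]) tact_word. Qed.

Lemma tact_emb i (a : G i) s : reduced s ->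
  tact (cp_emb a) s = if i == j then mul_head (cp_emb a) s else shift (cp_emb a) s.
Proof. by move=> rs; rewrite tact_word//= /step /=; case: ifP. Qed.

Lemma tact_vtx a s : vtx a -> reduced s -> tact a s = mul_head a s.
Proof.
move=> <- rs; elim/cp_ind: a => [|i a g IHg]; first by rewrite ret1 tact1// mul_head1.
rewrite retM tactM// IHg ret_emb /=; case: ifP => ij; last first.
  by rewrite mul1g tact1//; apply: mul_head_red.
by rewrite tact_emb ?ij ?mul_headM//; apply: mul_head_red.
Qed.

Lemma tact_cpl p s : cpl p -> reduced s -> tact p s = shift p s.
Proof.
move=> <- rs; elim/cp_ind: p => [|i a g IHg]; first by rewrite ret1 tact1// shift1.
rewrite retM tactM// IHg ret_emb /=; case: ifPn => ij; last first.
  by rewrite mul1g tact1//; apply: shift_red.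
by rewrite tact_emb ?(negbTE ij) ?shiftM//; apply: shift_red.
Qed.

(* Twice the length of the common prefix, plus one if the paths leave it along
   the same clique. *)
Fixpoint gp s t : nat :=
  match s, t with
  | (w, a) :: s', (v, b) :: t' =>
      if w == v then if a == b then (gp s' t').+2 else 1%N else 0%N
  | _, _ => 0%N
  end.

Lemma gpC s t : gp s t = gp t s.
Proof.
elim: s t => [|[w a] s IHs] [|[v b] t] //=.
by rewrite eq_sym [a == _]eq_sym IHs.
Qed.

Lemma gp_ultra s t u : (minn (gp s t) (gp t u) <= gp s u)%N.
Proof.
elim: s t u => [|[w a] s IHs] [|[v b] t] [|[x c] u] //=; rewrite ?minn0 ?min0n //.
case: (eqVneq w v) => [->|_]; last by rewrite min0n.
case: (eqVneq v x) => [_|_]; last by rewrite minn0.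
case: (eqVneq a b) => [->|ab]; case: (eqVneq b c) => [e|bc].
- by have := IHs t u; lia.
- by lia.
- by case: ifP; lia.
- by case: ifP; lia.
Qed.

Lemma gp_shift p s t : gp (shift p s) (shift p t) = gp s t.
Proof.
elim: s t => [|[w a] s IHs] [|[v b] t] //=; rewrite IHs.
by rewrite (inj_eq (@lcoset_inj _ p)).
Qed.

Lemma gp_cons_base c d s t : nonbase s -> nonbase t ->
  (gp (cons_base c s) (cons_base d t) + (c != d) =
   (if c == d then gp s t else 0) + (c != 1%g) + (d != 1%g))%N.
Proof.
move=> ns nt; rewrite /cons_base.
case: (eqVneq c 1) => [->|c1]; have [e|d1] := eqVneq d 1; rewrite /=.
- by lia.
- by case: s ns => [|[w b] s] /= => [_|/negbTE ->]; lia.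
- rewrite e (negbTE c1); case: t nt => [|[w b] t] /=; first lia.
  by rewrite eq_sym => /negbTE ->; lia.
- by rewrite eqxx; case: eqVneq; lia.
Qed.

(** Steps are isometries: [size s + size t - gp s t] is the distance between the ends of two
    paths. *)
Lemma gp_step z s t : reduced s -> reduced t ->
  (size (step z s) + size (step z t) + gp s t =
   size s + size t + gp (step z s) (step z t))%N.
Proof.
move=> rs rt; rewrite /step; case: ifP => _; last by rewrite gp_shift !size_map.
move: (word_class _) => a; have /andP[_ ns] := tail_base_red rs.
have /andP[_ nt] := tail_base_red rt.
have := gp_cons_base (head_coef s) (head_coef t) ns nt.
have := gp_cons_base (a * head_coef s) (a * head_coef t) ns nt.
rewrite (inj_eq (mulgI a)) !cons_baseK// -!/(mul_head _ _).
have sz c u : size (cons_base c u) = ((c != 1%g) + size u)%N.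
  by rewrite /cons_base; case: eqP.
have szK u : reduced u -> size u = ((head_coef u != 1%g) + size (tail_base u))%N.
  by move=> ru; rewrite -sz cons_baseK.
by rewrite (szK _ rs) (szK _ rt) !sz; case: ifP; lia.
Qed.

Lemma gp_tact g s t : reduced s -> reduced t ->
  (size (tact g s) + size (tact g t) + gp s t =
   size s + size t + gp (tact g s) (tact g t))%N.
Proof.
move=> rs rt; rewrite /tact; elim: (repr g) => //= z u.
have foldR w : reduced w -> reduced (foldr step w u).
  by move=> rw; elim: u => //= z' u; exact: step_red.
by have := gp_step z (foldR _ rs) (foldR _ rt); lia.
Qed.

End Tree.

(** * Normal forms and lengths of group elements *)

Section TreeElements.
Variables (n : nat) (n_ge5 : (5 <= n)%N) (G : 'I_n -> groupType) (j : 'I_n).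
Local Notation C := (cyclic_product G).
Local Notation vtx := (par (G := G) (pred1 j)).
Local Notation cpl := (par (G := G) (predC1 j)).
Local Notation base := (par (G := G) (link j)).
Local Notation starj := (par (G := G) (star j)).
Local Notation tact := (tact j).
Implicit Types (g h x y p a c : C) (S : pred 'I_n).

Definition nf g : seq (letter G) := tact g [::].
Definition len g : nat := size (nf g).
Definition gpr g h : nat := gp (nf g) (nf h).
Arguments nf g%_g.
Arguments len g%_g.
Arguments gpr (g h)%_g.

Lemma nf_red g : reduced (nf g).
Proof. exact: tact_red. Qed.

Lemma nfM g h : nf (g * h) = tact g (nf h).
Proof. exact: tactM. Qed.

Lemma nf1 : nf 1 = [::].
Proof. exact: tact1. Qed.

Lemma nf_cplM p g : cpl p -> nf (p * g) = shift p (nf g).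
Proof. by move=> pc; rewrite nfM tact_cpl//; exact: nf_red. Qed.

Lemma nf_cpl p : cpl p -> nf p = [::].
Proof. by move=> pc; rewrite -[p]mulg1 nf_cplM// nf1. Qed.

Lemma nf_Mcpl p g : cpl p -> nf (g * p) = nf g.
Proof. by move=> pc; rewrite nfM nf_cpl. Qed.

Lemma nf_vtxM a g : vtx a -> nf (a * g) = mul_head j a (nf g).
Proof. by move=> av; rewrite nfM tact_vtx//; exact: nf_red. Qed.

Lemma nf_vtxM_cons a g : vtx a -> a <> 1 -> nonbase j (nf g) ->
  nf (a * g) = (base, a) :: nf g.
Proof.
move=> av /eqP a1 ng; rewrite nf_vtxM// /mul_head.
have -> : tail_base j (nf g) = nf g by case: (nf g) ng => //= l s /negbTE ->.
have -> : head_coef j (nf g) = 1 by case: (nf g) ng => //= l s /negbTE ->.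
by rewrite mulg1 /cons_base (negbTE a1).
Qed.

Lemma nf_vtx a : vtx a -> a <> 1 -> nf a = [:: (base, a)].
Proof. by move=> av a1; rewrite -[a in LHS]mulg1 nf_vtxM_cons// nf1. Qed.

Lemma len_gprE g k h : g * k = h -> (len k + gpr g h = len g + len h)%N.
Proof.
move=> <-; have := @gp_tact _ n_ge5 _ j g [::] (nf k) isT (nf_red k).
by rewrite -nfM /= addn0 add0n => e; rewrite -e.
Qed.

Lemma len_one : len 1 = 0%N.
Proof. by rewrite /len nf1. Qed.

Lemma gpr_ultram g h k : (minn (gpr g h) (gpr h k) <= gpr g k)%N.
Proof. exact: gp_ultra. Qed.

Lemma gprC g h : gpr g h = gpr h g.
Proof. exact: gpC. Qed.

Lemma len_cpl p : cpl p -> len p = 0%N.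
Proof. by move=> /nf_cpl e; rewrite /len e. Qed.

Lemma len_inv g : len g^-1 = len g.
Proof. exact: lenV len_gprE len_one g. Qed.

Lemma len_mul g h : (len (g * h) <= len g + len h)%N.
Proof. exact: lenM len_gprE len_one _ _. Qed.

Lemma len_vtx a : vtx a -> (len a <= 1)%N.
Proof.
move=> av; rewrite /len; have [->|/eqP a1] := eqVneq a 1; first by rewrite nf1.
by rewrite nf_vtx.
Qed.

Lemma link_cpl p : base p -> cpl p.
Proof.
apply: par_sub => i; apply: contraTneq => ->.
by rewrite /link /= (adj_irr n_ge5).
Qed.

Lemma len_star x : starj x -> (len x <= 1)%N.
Proof.
move=> /(par_star_split n_ge5) ->; rewrite /len nf_Mcpl; last first.
  exact/link_cpl/par_ret.
exact/len_vtx/par_ret.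
Qed.

Definition word_val (v : seq (C * C)) : C := foldr (fun l x => l.2 ^ l.1^-1 * x) 1 v.

(** Letters only know cosets; [v] chooses representatives within the span of [S], from which the
    element is recovered up to a right factor without index [j]. *)
Lemma nf_decomp S g : exists v : seq (C * C),
  [/\ nf (ret S g) = [seq (lcoset l.1 base, l.2) | l <- v],
      forall l, l \in v -> par (predI S (predC1 j)) l.1 /\ vtx l.2
    & ret S g = word_val v * ret (predC1 j) (ret S g)].
Proof.
elim/cp_ind: g => [|i a g [v [IH1 IH2 IH3]]].
  by exists [::]; rewrite !ret1 nf1 mulg1.
rewrite retM; case Si : (S i); last first.
  by exists v; rewrite ret_emb Si mul1g.
rewrite ret_emb Si nfM (tact_emb n_ge5); last exact: nf_red.
rewrite IH1; case: ifPn => ij; last first.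
  exists [seq (cp_emb a * l.1, l.2) | l <- v]; split.
  - by rewrite /shift -!map_comp; apply: eq_map => l /=; rewrite lcosetM.
  - move=> _ /mapP[l /IH2[lS lv] ->] /=; split=> //; apply: parM lS.
    by apply: par_emb; rewrite /= Si ij.
  - have -> : word_val [seq (cp_emb a * l.1, l.2) | l <- v] =
        word_val v ^ (cp_emb a)^-1.
      elim: (v) => [|l v' IHv] /=; first by rewrite conj1g.
      by rewrite IHv conjMg -conjgM invgM.
    rewrite retM ret_emb /= ij {1}IH3 conjgE invgK !mulgA mulgVK.
    by [].
have av : vtx (cp_emb a) by apply: par_emb; rewrite /= ij.
have c1 : ret (predC1 j) (cp_emb a * ret S g) = ret (predC1 j) (ret S g).
  by rewrite retM ret_emb /= ij mul1g.
rewrite c1.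
have cons_case v' b : vtx b -> (forall l, l \in v' -> par (predI S (predC1 j)) l.1 /\ vtx l.2) ->
  exists v0 : seq (C * C),
  [/\ cons_base j b [seq (lcoset l.1 base, l.2) | l <- v'] =
       [seq (lcoset l.1 base, l.2) | l <- v0],
      forall l, l \in v0 -> par (predI S (predC1 j)) l.1 /\ vtx l.2
    & word_val v0 = b * word_val v'].
  move=> bv v'P; rewrite /cons_base; case: eqP => [->|_].
    by exists v'; rewrite mul1g.
  exists ((1, b) :: v'); split=> /=.
  - by rewrite lcoset1.
  - by move=> l; rewrite inE => /orP[/eqP ->|/v'P//]; split=> //; exact: par1.
  - by rewrite invg1 conjg1.
rewrite /mul_head; case: v IH1 IH2 IH3 => [|[p b] v] /= IH1 IH2 IH3.
  have [|v0 [e0 v0P e]] := cons_case [::] (cp_emb a) av; first by move=> l; rewrite in_nil.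
  exists v0; split=> //; first by rewrite mulg1.
  by rewrite e /= mulg1 {1}IH3 mul1g.
case: eqP => [/lcoset_base bp|_].
  have [pP bv] := IH2 _ (mem_head _ _).
  have [||v0 [e0 v0P e]] := cons_case v (cp_emb a * b).
  - exact: parM.
  - by move=> l lv; apply: IH2; rewrite inE lv orbT.
  exists v0; split=> //; rewrite e {1}IH3 (@conjg_comm _ b) ?mulgA//.
  apply/commuteV/(@par_comm _ _ (pred1 j) (link j)) => //.
  by move=> i' k /eqP ->.
have [|v0 [e0 v0P e]] := cons_case ((p, b) :: v) (cp_emb a) av; first exact: IH2.
exists v0; split=> //; first by rewrite mulg1 e0.
by rewrite e {1}IH3 /= !mulgA.
Qed.

Lemma ret_predT g : ret predT g = g.
Proof. by rewrite /ret filter_predT word_classK. Qed.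

Lemma len0_cpl g : len g = 0%N -> cpl g.
Proof.
have [v [e _ +]] := nf_decomp predT g; rewrite ret_predT in e *.
rewrite /len e size_map => /[swap] /size0nil -> /=.
by rewrite mul1g => /esym.
Qed.

(** Each letter is a conjugate of an element of [G j] by an element without index [j]; its
    retraction has the same shape, hence length at most 1. *)
Lemma len_ret S g : (len (ret S g) <= len g)%N.
Proof.
have [v [e vP +]] := nf_decomp predT g; rewrite ret_predT in e *.
move=> {1}->; rewrite {2}/len e size_map retM.
apply: leq_trans (len_mul _ _) _.
rewrite [len (ret S (ret _ _))]len_cpl ?addn0; last first.
  by apply: (ret_par (par_ret (predC1 j) g)).
elim: v {e} vP => [|l v IHv] vP /=; first by rewrite ret1 len_one.
rewrite retM; apply: leq_trans (len_mul _ _) _; rewrite -[(size v).+1]add1n.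
apply: leq_add; last by apply: IHv => k kv; apply: vP; rewrite inE kv orbT.
have [lp lv] := vP _ (mem_head _ _).
rewrite conjgE invgK !retM retV; apply: leq_trans (len_mul _ _) _.
rewrite len_cpl ?add0n; last by apply: (ret_par lp) => i /= _.
apply: leq_trans (len_mul _ _) _; rewrite len_inv (@len_cpl (ret S l.1)) ?addn0.
  by apply: len_vtx; apply: (ret_par lv).
by apply: (ret_par lp) => i /= _.
Qed.

Lemma nf_letter S g w a : par S g -> (w, a) \in nf g ->
  [/\ exists2 p, par (predI S (predC1 j)) p & w = lcoset p base, vtx a & a <> 1].
Proof.
move=> <- wa; have [v [e vP _]] := nf_decomp S g; have a1 : a <> 1.
  have /andP[/allP/(_ _ wa)/eqP] := nf_red (ret S g); by [].
move: wa; rewrite e => /mapP[l /vP[lp lv] [-> ea]]; split=> //; last by rewrite ea.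
by exists l.1.
Qed.

End TreeElements.

Arguments nf {n G} j g%_g.
Arguments len {n G} j g%_g.
Arguments gpr {n G} j (g h)%_g.

Lemma ex_min_nat (T : Type) (P : T -> Prop) (f : T -> nat) :
  (exists x, P x) -> exists2 x, P x & forall y, P y -> (f x <= f y)%N.
Proof.
case=> x Px; elim/ltn_ind: {x}(f x) {-2}x (leqnn (f x)) Px => m IHm x fx Px.
have [[y Py yx]|no] := pselect (exists2 y, P y & (f y < f x)%N).
  by apply: (IHm (f y)) Py => //; exact: leq_trans fx.
by exists x => // y Py; rewrite leqNgt; apply/negP => yx; apply: no; exists y.
Qed.

(** * Elliptic and loxodromic elements *)

Section TreeDynamics.
Variables (n : nat) (n_ge5 : (5 <= n)%N) (G : 'I_n -> groupType) (j : 'I_n).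
Local Notation C := (cyclic_product G).
Local Notation vtx := (par (G := G) (pred1 j)).
Local Notation cpl := (par (G := G) (predC1 j)).
Local Notation base := (par (G := G) (link j)).
Local Notation starj := (par (G := G) (star j)).
Local Notation nf := (nf j).
Local Notation len := (len j).
Local Notation gpr := (gpr j).
Implicit Types (g h x y p a c k : C) (S : pred 'I_n).

Lemma vtx_star x : vtx x -> starj x.
Proof. by apply: par_sub => i ij; rewrite /star /=; apply/orP; left. Qed.

Lemma base_star x : base x -> starj x.
Proof. by apply: par_sub => i ij; rewrite /star /=; apply/orP; right. Qed.

Lemma vtx_base_comm a p : vtx a -> base p -> commute a p.
Proof. by apply: par_comm => i k /= /eqP ->. Qed.

Lemma len_gprV g h : (len (g^-1 * h) + gpr g h = len g + len h)%N.
Proof. exact: (len_gprE n_ge5 j (mulVKg g h)). Qed.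

Lemma len_gprM g h : (len (g * h) + gpr g^-1 h = len g + len h)%N.
Proof. rewrite -(len_inv n_ge5 j g); exact: (len_gprE n_ge5 j (mulKg g h)). Qed.

Lemma vtx_len1 a : vtx a -> a <> 1 -> len a = 1%N.
Proof. by move=> av a1; rewrite /len nf_vtx. Qed.

(* [far g]: the clique of [G j] at the base point does not lie on the path
   to [g]. *)
Definition far g := nonbase j (nf g).

Lemma far_gpr a g : vtx a -> a <> 1 -> far g <-> gpr a g = 0%N.
Proof.
move=> av a1; rewrite /far /gpr (nf_vtx n_ge5 av a1) /nonbase; case: (nf g) => //= -[w b] s.
by rewrite eq_sym /=; case: eqVneq => //= _; split=> //; case: ifP.
Qed.

Lemma far_trans g h : (0 < gpr g h)%N -> far g -> far h.
Proof.
rewrite /far /gpr; case: (nf g) (nf h) => [|[w a] s] [|[v b] t] //=.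
by case: eqVneq => // ->.
Qed.

Lemma far_split g : exists2 a, vtx a & far (a * g).
Proof.
have rg := nf_red j g; case e : (nf g) rg => [|[w a] s] rg.
  by exists 1; [exact: par1|rewrite mul1g /far e].
have /andP[_] := tail_base_red j rg; rewrite /=.
case: eqP => [ew ns|/eqP ne _]; last first.
  by exists 1; [exact: par1|rewrite mul1g /far e /= ne].
have [|_ av a1] := nf_letter n_ge5 (ret_predT g) (_ : (w, a) \in nf g).
  by rewrite e mem_head.
exists a^-1; first exact: parV.
rewrite /far nf_vtxM//; last exact: parV.
by rewrite e /mul_head /= ew eqxx mulVg /cons_base eqxx.
Qed.

Lemma far_cons a g : vtx a -> a <> 1 -> far g -> nf (a * g) = (base, a) :: nf g.
Proof. exact: nf_vtxM_cons. Qed.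

Lemma neq1V x : x <> 1 -> x^-1 <> 1.
Proof. by move=> x1 /eqP; rewrite invg_eq1 => /eqP. Qed.

Lemma neq1J x g : x <> 1 -> x ^ g <> 1.
Proof. by move=> x1 /eqP; rewrite conjg_eq1 => /eqP. Qed.

(* Geometrically: an element of the star subgroup with a nontrivial
   component in [G j] fixes a single vertex of the tree. *)
Lemma star_conj x g : starj x -> ret (pred1 j) x <> 1 -> starj (x ^ g) -> starj g.
Proof.
wlog fg : x g / far g => [hw|] sx x1 sxg.
  have [a av fag] := far_split g.
  rewrite -[g](mulKg a); apply: parM; first exact/parV/vtx_star.
  apply: (hw (x ^ a^-1)) => //; last by rewrite conjgM conjgKV.
    by apply: parJ => //; exact/parV/vtx_star.
  rewrite retJ; exact: neq1J.
set a := ret (pred1 j) x in x1.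
have av : vtx a by exact: par_ret.
have xE : x = a * ret (link j) x by exact: par_star_split.
set w := ret (link j) x in xE; have wb : base w by exact: par_ret.
have fwg : far (w * g).
  by rewrite /far nf_cplM// ?shift_nonbase//; exact: link_cpl.
(* The path to [x * g] starts in the clique of [G j] and the path to [g] does not, so [x ^ g] has
   length [2 * len g + 1]; in a star subgroup this is at most 1. *)
have lg : len g = 0%N.
  have : (len (g^-1 * (x * g)) <= 1)%N by exact: len_star.
  have := len_gprV g (x * g).
  have -> : gpr g (x * g) = 0%N.
    rewrite /gpr xE -mulgA far_cons//.
    move: fg; rewrite /far; case: (nf g) => //= -[v b] s.
    by case: eqVneq.
  have -> : len (x * g) = (len g).+1.
    rewrite xE -mulgA /len far_cons//= nf_cplM ?size_map//; exact: link_cpl.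
  lia.
have gc : cpl g by exact: len0_cpl.
have gv : ret (pred1 j) g = 1 by apply: (ret_par1 gc) => i /= /eqP ->; rewrite eqxx.
have e1 : nf (x ^ g) = [:: (lcoset g^-1 base, a)].
  rewrite conjgE nf_cplM//; last exact: parV.
  by rewrite nf_Mcpl// xE nf_Mcpl ?nf_vtx//; exact: link_cpl.
have e2 : nf (x ^ g) = [:: (base, a)].
  rewrite (par_star_split n_ge5 sxg) nf_Mcpl//; last exact/link_cpl/par_ret.
  by rewrite retJ gv conjg1 nf_vtx.
move: e2; rewrite e1 => -[/lcoset_base/parVE gb].
exact: base_star.
Qed.

Lemma star_comm x y : starj x -> ret (pred1 j) x <> 1 -> commute x y -> starj y.
Proof. by move=> sx x1 xy; apply: (star_conj sx) => //; rewrite conjg_comm. Qed.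

Local Notation lox := (lox len).

Lemma lox_gpr x : (0 < len x)%N -> gpr x^-1 x = 0%N -> lox x.
Proof.
move=> x0 gx; split=> //; suff : len (x * x) = (len x).*2 by [].
by have := len_gprM x x; rewrite gx; lia.
Qed.

(** If [x] moves the base point and is not loxodromic, the paths to its images under [x] and [x^-1]
    start in the same clique; [x] preserves that clique, or a conjugate would be shorter. *)
Lemma min_len_lox x : (forall g, len x <= len (x ^ g))%N ->
  [\/ lox x, cpl x | exists q, starj (x ^ q)].
Proof.
move=> xmin; have [x0|] := posnP (len x); first by constructor 2; exact: len0_cpl.
move=> x0; have [gx|] := posnP (gpr x^-1 x); first by constructor 1; exact: lox_gpr.
move=> gx; constructor 3.
case ex : (nf x) => [|[w a] s]; first by rewrite /len ex in x0.
have [|[q qc ew] av a1] := nf_letter n_ge5 (ret_predT x) (_ : (w, a) \in nf x).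
  by rewrite ex mem_head.
have {}qc : cpl q by apply: par_sub qc => i /=.
pose y : C := x ^ q.
have ey : nf y = (base, a) :: shift q^-1 s.
  rewrite /y conjgE nf_cplM ?nf_Mcpl//; last exact: parV.
  by rewrite ex /= ew lcosetK.
have [b [s' eyV]] : exists b s', nf y^-1 = (base, b) :: s'.
  rewrite /y -conjVg conjgE nf_cplM ?nf_Mcpl//; last exact: parV.
  move: gx; rewrite /gpr ex; case: (nf x^-1) => [|[v b] s'] //=.
  by case: eqVneq => // -> _; exists b, (shift q^-1 s'); rewrite ew lcosetK.
have ly : len y = len x by rewrite /len ey ex /= size_map.
pose p : C := a^-1 * y; have yM : y = a * p by rewrite mulVKg.
have [y1|y2] := eqVneq (len y) 1%N.
  have pc : cpl p.
    apply: len0_cpl => //; rewrite /len nf_vtxM//; last exact: parV.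
    rewrite ey /mul_head /= eqxx mulVg /cons_base eqxx.
    by move: y1; rewrite /len ey /= => -[].
  exists q; rewrite -/y yM; apply: parM; first exact: vtx_star.
  have aV1 : a^-1 <> 1 by exact: neq1V.
  move: eyV; rewrite yM invgM nf_cplM//; last exact: parV.
  rewrite nf_vtx//; last exact: parV.
  by case=> /lcoset_base/parVE pb _ _; exact: base_star.
(* [y * a] is not longer than [y], because [y^-1] starts in the clique of [a]; multiplying by [a^-1]
   then cancels its first letter, against minimality. *)
have : (len y <= len (y ^ a))%N by rewrite ly /y -conjgM.
have l2 : (1 < len y)%N by lia.
have la : len a = 1%N by exact: vtx_len1.
have g1 : (0 < gpr y^-1 a)%N.
  by rewrite /gpr eyV nf_vtx//= eqxx; case: ifP.
have g2 : gpr a y = 2%N by rewrite /gpr nf_vtx// ey /= !eqxx.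
have := len_gprM y a; have := len_gprV y (y * a); have := len_gprV a (y * a).
have -> : len (y^-1 * (y * a)) = len a by rewrite mulKg.
have := gpr_ultram n_ge5 j a y (y * a).
have : (len y <= len (y * a) + len a)%N.
  by rewrite -{1}(mulgK a y) -(len_inv n_ge5 _ a); exact: len_mul.
have -> : len (y ^ a) = len (a^-1 * (y * a)) by [].
lia.
Qed.

Lemma far_cons_gpr a g h : vtx a -> a <> 1 -> far g -> far h -> gpr (a * g) h = 0%N.
Proof.
move=> av a1 fg; rewrite /far /gpr far_cons//; case: (nf h) => //= -[w b] s /=.
by rewrite eq_sym => /negbTE ->.
Qed.

Lemma far_min g : (forall a, vtx a -> len g <= len (a * g))%N -> far g.
Proof.
move=> gmin; have [a av fag] := far_split g.
have [a1|/eqP a1] := eqVneq a 1; first by rewrite a1 mul1g in fag.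
have := far_cons (parV av) (neq1V a1) fag; rewrite mulKg => e.
by have := gmin _ av; rewrite {1}/len e /= ltnn.
Qed.

(** Ping-pong: [c] and [d ^ k^-1] each fix a single star vertex, and these differ as [k] is not in
    the star subgroup. The [far] hypotheses put the base point on the segment between them, hence on
    the axis of the product. *)
Lemma far_conj_prod_lox c d k : vtx c -> c <> 1 -> vtx d -> d <> 1 ->
  far k -> far k^-1 -> ~ starj k -> lox (c * d ^ k^-1).
Proof.
move=> cv c1 dv d1 fk fkV ks.
have lkb b : vtx b -> b <> 1 -> len (k * b) = (len k).+1.
  move=> bv b1; have := len_gprM k b; rewrite gprC (far_gpr _ bv b1).1//.
  by rewrite (vtx_len1 bv b1); lia.
have fkb b : vtx b -> b <> 1 -> far (k * b).
  move=> bv b1; have [k0|kpos] := posnP (len k).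
    have kc : cpl k by exact: len0_cpl.
    rewrite /far nf_cplM// (nf_vtx n_ge5 bv b1) /=; apply/eqP => /lcoset_base kb.
    exact/ks/base_star.
  apply: far_trans fk; have := len_gprV k (k * b).
  have -> : len (k^-1 * (k * b)) = len b by rewrite mulKg.
  by rewrite lkb// (vtx_len1 bv b1); lia.
have lz b : vtx b -> b <> 1 -> len (k * b * k^-1) = (len k).*2.+1.
  move=> bv b1; have := len_gprM (k * b) k^-1.
  have -> : gpr (k * b)^-1 k^-1 = 0%N.
    by rewrite invgM far_cons_gpr//; [exact: parV|exact: neq1V].
  by rewrite lkb// len_inv//; lia.
have fz b : vtx b -> b <> 1 -> far (k * b * k^-1).
  move=> bv b1; apply: far_trans (fkb b bv b1).
  have := len_gprV (k * b) (k * b * k^-1).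
  have -> : len ((k * b)^-1 * (k * b * k^-1)) = len k by rewrite mulKg len_inv.
  by rewrite lz// lkb//; lia.
pose z := k * d * k^-1; pose y := k * d^-1 * k^-1.
have zV : z^-1 = y by rewrite /z /y !invgM invgK mulgA.
have yV : y^-1 = z by rewrite -zV invgK.
have [dVv dV1] : vtx d^-1 /\ d^-1 <> 1 by split; [exact: parV|exact: neq1V].
have [cVv cV1] : vtx c^-1 /\ c^-1 <> 1 by split; [exact: parV|exact: neq1V].
have -> : d ^ k^-1 = z by rewrite conjgE invgK mulgA.
have fy : far (y * c^-1).
  apply: far_trans (fz _ dVv dV1); rewrite -/y.
  have := len_gprV y (y * c^-1).
  have -> : len (y^-1 * (y * c^-1)) = 1%N by rewrite mulKg (vtx_len1 cVv cV1).
  have := len_gprM y c^-1.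
  rewrite yV gprC (far_gpr _ cVv cV1).1 ?(vtx_len1 cVv cV1) ?lz//; first lia.
  exact: fz.
apply: lox_gpr; first by rewrite /len far_cons//; exact: fz.
by rewrite gprC invgM zV; apply: far_cons_gpr => //; exact: fz.
Qed.

(** A shortest element of the double coset of [k] modulo [G j] satisfies both [far] hypotheses of
    [far_conj_prod_lox]. *)
Lemma star_conj_prod c k : vtx c -> c <> 1 -> ~ starj k ->
  exists q, lox ((c * c ^ k^-1) ^ q).
Proof.
move=> cv c1 ks.
have [|[u v] /= [uv vv] kmin] := ex_min_nat (P := fun w : C * C => vtx w.1 /\ vtx w.2)
    (fun w => len (w.1 * k * w.2)).
  by exists (1, 1); split; exact: par1.
pose k0 := u * k * v; exists u^-1.
have -> : (c * c ^ k^-1) ^ u^-1 = c ^ u^-1 * (c ^ v) ^ k0^-1.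
  rewrite conjMg -!conjgM; congr (_ * c ^ _).
  by rewrite /k0 !invgM mulVKg.
have cuv : vtx (c ^ u^-1) by apply: parJ => //; exact: parV.
have cvv : vtx (c ^ v) by exact: parJ.
apply: far_conj_prod_lox => //; try exact: neq1J.
- apply: far_min => a av.
  have := kmin (a * u, v); rewrite /= !mulgA; apply; split=> //; exact: parM.
- apply: far_min => a av; rewrite len_inv// -[len (a * _)]len_inv// invgM invgK.
  have := kmin (u, v * a^-1); rewrite /= !mulgA; apply; split=> //.
  by apply: parM => //; exact: parV.
- move=> sk0; apply: ks; have -> : k = u^-1 * k0 * v^-1.
    by rewrite /k0 !mulgA mulVg mul1g mulgK.
  by apply: parM; [apply: parM|] => //; exact/parV/vtx_star.
Qed.

Lemma fix_letter c x w a : cpl c -> commute c x -> (w, a) \in nf x ->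
  lcoset c w = w.
Proof.
move=> cc cx wx; have : shift c (nf x) = nf x by rewrite -nf_cplM// cx nf_Mcpl.
elim: (nf x) wx => //= l s IHs; rewrite inE => /orP[/eqP<- [->]//|ws [_ /IHs]].
exact.
Qed.

(** An element that fixes the base point and commutes with [x] preserves the normal form of [x * x],
    hence every coset in it. *)
Lemma lox_fix S x : par S x -> lox x -> exists p1 p2,
  [/\ par (predI S (predC1 j)) p1, par (predI S (predC1 j)) p2, ~ base (p1^-1 * p2) &
     forall c, cpl c -> commute c x -> base (c ^ p1) /\ base (c ^ p2)].
Proof.
move=> Sx [x0 xx].
have Sxx : par S (x * x) by exact: parM.
(* Two distinct cosets are wanted, and [x] itself may have a single letter. *)
have := nf_red j (x * x); case e : (nf (x * x)) => [|[w1 a1] [|[w2 a2] s]].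
- by move: xx; rewrite {1}/len e /=; lia.
- by move: xx; rewrite {1}/len e /=; lia.
have [|[p1 S1 e1] _ _] := nf_letter n_ge5 Sxx (_ : (w1, a1) \in nf (x * x)).
  by rewrite e mem_head.
have [|[p2 S2 e2] _ _] := nf_letter n_ge5 Sxx (_ : (w2, a2) \in nf (x * x)).
  by rewrite e inE mem_head orbT.
move=> /andP[_ /= /andP[w12 _]]; exists p1, p2; split=> //.
  move=> bp; case/eqP: w12; rewrite e1 e2.
  by apply/lcoset_eq => //; exact: par_subgroup.
have fixb c p : lcoset c (lcoset p base) = lcoset p base -> base (c ^ p).
  by move=> h; apply/lcoset_base; rewrite conjgE !lcosetM h lcosetK.
move=> c cc cx; have cxx : commute c (x * x) by exact: commuteM.
split; apply: fixb.
  by rewrite -e1; apply: (fix_letter (a := a1) cc cxx); rewrite e mem_head.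
by rewrite -e2; apply: (fix_letter (a := a2) cc cxx); rewrite e inE mem_head orbT.
Qed.

End TreeDynamics.

(** * Centralizers and commuting subgroups *)

Section Centralizers.
Variables (n : nat) (n_ge5 : (5 <= n)%N) (G : 'I_n -> groupType).
Local Notation C := (cyclic_product G).
Implicit Types (i j m : 'I_n) (g h w x y z p b c : C) (S : pred 'I_n).

Lemma adjS j : adj j (ordS j).
Proof. by rewrite /adj eqxx. Qed.

Lemma adjP j : adj j (ord_pred j).
Proof. by rewrite /adj ord_predK eqxx orbT. Qed.

Lemma adj_cases j k : adj j k -> k = ordS j \/ k = ord_pred j.
Proof. by move=> /orP[/eqP|/eqP ->]; [left|right; rewrite ordSK]. Qed.

Lemma ordS_neq_pred j : ordS j != ord_pred j.
Proof.
apply/eqP => e; have e2 : ordS (ordS j) = j by rewrite e ord_predK.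
have := congr1 (@nat_of_ord n) e2; rewrite !(val_ordS n_ge5).
by have := ltn_ord j; case: (ltnP j.+1 n); case: ifP; lia.
Qed.

Lemma retX S g k : ret S (g ^+ k) = ret S g ^+ k.
Proof. by elim: k => [|k IHk]; rewrite ?expg0 ?ret1// !expgS retM IHk. Qed.

Lemma retR S g h : ret S [~ g, h] = [~ ret S g, ret S h].
Proof. by rewrite !commgEl retM retV retJ. Qed.

Lemma ret_commute S g h : commute g h -> commute (ret S g) (ret S h).
Proof. by rewrite /commute -!retM => ->. Qed.

Definition vertexlike x := exists g m, par (pred1 m) (x ^ g).

Lemma vertexlikeJ x g : vertexlike (x ^ g) <-> vertexlike x.
Proof.
split=> -[h [m hm]]; first by exists (g * h), m; rewrite conjgM.
by exists (g^-1 * h), m; rewrite -conjgM mulVKg.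
Qed.

Lemma vtx_comm_star c m h y : c <> 1 -> par (pred1 m) (c ^ h) -> commute c y ->
  par (star m) (y ^ h).
Proof.
move=> c1 cm cy; apply: (star_comm n_ge5 (vtx_star cm)); last exact: commuteJ.
by rewrite cm; exact: neq1J.
Qed.

Lemma lox_expg_len j x k : lox (len j) x -> len j (x ^+ k) = (k * len j x)%N.
Proof. exact: (lox_expg (len_gprE n_ge5 j) (len_one n_ge5 G j) (gpr_ultram n_ge5 j)). Qed.

Lemma lox_not_vertexlike j x q : lox (len j) (x ^ q) -> ~ vertexlike x.
Proof.
move=> lx [g [m xm]].
have [k] := lox_unbounded (len_gprE n_ge5 j) (len_one n_ge5 G j)
  (gpr_ultram n_ge5 j) (q^-1 * g) 1 lx.
rewrite -conjgM mulVKg; apply/negP; rewrite -leqNgt.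
have : par (pred1 m) ((x ^ g) ^+ k) by rewrite /par/= retX xm.
have [->|mj] := eqVneq m j; first exact: len_vtx.
move=> xk; rewrite len_cpl//; apply: par_sub xk => i /= /eqP ->; exact: mj.
Qed.

(* The pointwise stabilizer of the axis is contained in [G j]: two points of the
   axis differ by an element of the other neighbour of [G j], whose centralizer
   meets the edge stabilizer in [G j] only, the cycle having no square. *)
Lemma link_lox j w : par (link j) w -> ~ vertexlike w ->
  exists h m, [/\ par (link j) h, adj j m, lox (len m) (w ^ h) &
    forall p, par (predC1 m) p -> commute p (w ^ h) -> par (pred1 j) p].
Proof.
move=> wj nw; pose m := ordS j; pose m' := ord_pred j.
have jm : adj j m := adjS j; have jm' : adj j m' := adjP j.
have mm' : m != m' := ordS_neq_pred j.
have single i : link j i -> predC1 m i -> i = m'.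
  by move=> /adj_cases[->|//]; rewrite /= eqxx.
have [|h0 _ h0min] := ex_min_nat (P := fun _ => True) (fun h => len m (w ^ h)).
  by exists 1.
(* The minimum over all conjugates is reached inside the link, since the retraction fixes [w] and
   does not increase lengths. *)
pose h := ret (link j) h0; have hj : par (link j) h by exact: par_ret.
have whj : par (link j) (w ^ h) by exact: parJ.
have nwh : ~ vertexlike (w ^ h) by rewrite vertexlikeJ.
have lw : lox (len m) (w ^ h).
  have [g|//|wc|[q sq]] := min_len_lox n_ge5 (j := m) (x := w ^ h).
  - rewrite -conjgM; apply: leq_trans (h0min _ I).
    have -> : w ^ h = ret (link j) (w ^ h0) by rewrite retJ wj.
    exact: len_ret.
  - case: nwh; exists 1, m'; rewrite conjg1; apply: par_and whj wc => i ij im.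
    by apply/eqP; exact: single.
  - case: nwh; exists (ret (link j) q), m.
    have -> : (w ^ h) ^ ret (link j) q = ret (link j) ((w ^ h) ^ q) by rewrite retJ whj.
    apply: (ret_par sq) => i /= ji /orP[//|mi].
    by case: (adj_trifree n_ge5 jm mi ji).
exists h, m; split=> // p pm pw.
have [p1 [p2 [S1 S2 np12 fixp]]] := lox_fix n_ge5 whj lw.
have [c1 c2] := fixp _ pm pw; set c := p ^ p1 in c1.
have {S1 S2} [[p1j S1] [_ S2]] : (par (link j) p1 /\ par (pred1 m') p1) /\
    (par (link j) p2 /\ par (pred1 m') p2).
  by do 2!split; (apply: par_sub S1 || apply: par_sub S2) => i /andP[ij im] //;
    apply/eqP; exact: single.
pose g := p1^-1 * p2; have gm' : par (pred1 m') g by apply: parM => //; exact: parV.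
have gm : ret (link m) g = 1.
  apply: (ret_par1 gm') => i /= mi /eqP ei; subst i.
  exact: (adj_trifree n_ge5 jm mi jm').
have gc : commute g c.
  have e : c ^ g = p ^ p2 by rewrite /c /g -conjgM mulVKg.
  have : ret (link m) (c ^ g) = ret (link m) (p ^ p2) by rewrite e.
  rewrite retJ gm c1 c2 -e conjg1 => e'; apply: commute_sym.
  have := eq_conj_comm (x := c) (g := g) (h := 1); rewrite invg1 mulg1 conjg1.
  exact.
have cs : par (star m') c.
  apply: (star_comm n_ge5 (vtx_star gm')) gc; rewrite gm' => g1.
  by apply: np12; rewrite -/g g1; exact: par1.
have cj : par (pred1 j) c.
  apply: par_and c1 cs => i mi /orP[/eqP e|m'i].
    by subst i; case: (adj_trifree n_ge5 jm mi jm').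
  apply/eqP/esym; apply: (adj_sqfree n_ge5 (i := m) (k := m')) => //.
  - by rewrite adj_sym.
  - by rewrite adj_sym.
have -> : p = c; last by [].
have cp1 : commute c p1 by exact: (vtx_base_comm cj).
by rewrite -[p](conjgK p1) -/c conjg_comm//; exact: commuteV.
Qed.

(* Removing from [y] its retraction to the star subgroup leaves an element that
   translates the axis of [w] by 0, because retractions do not increase lengths. *)
Lemma link_centralizer j w y : par (link j) w -> ~ vertexlike w -> commute w y ->
  par (star j) y.
Proof.
move=> wj nw wy; have [h [m [hj jm lw wfix]]] := link_lox wj nw.
pose w1 := w ^ h; pose y1 := y ^ h.
have w1j : par (link j) w1 by exact: parJ.
have w1s : par (star j) w1 by exact: base_star.
have wy1 : commute w1 y1 by exact: commuteJ.
pose p := (ret (star j) y1)^-1 * y1.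
have ls : subpred (link j) (star j) by move=> i ji; rewrite /star /= orbC; apply/orP; left.
have vs : subpred (pred1 j) (star j) by move=> i ji; rewrite /star /=; apply/orP; left.
have retp S : subpred S (star j) -> ret S p = 1.
  by move=> Ss; rewrite retM retV ret_sub// mulVg.
have pw : commute w1 p.
  apply: commuteM => //; apply: commuteV; rewrite -[w1]w1s; exact: ret_commute.
have ge q k : ret (link j) q = 1 -> (k * len m w1 <= len m (q * w1 ^+ k))%N.
  move=> q1; rewrite -lox_expg_len//.
  have e : w1 ^+ k = ret (link j) (q * w1 ^+ k) by rewrite retM q1 mul1g retX w1j.
  by rewrite {1}e; exact: len_ret.
have p0 : len m p = 0%N.
  apply: (lox_comm_ge (len_gprE n_ge5 m) (len_one n_ge5 G m) (gpr_ultram n_ge5 m) lw pw).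
    by move=> k; apply: ge; exact: retp.
  by move=> k; apply: ge; rewrite retV retp// invg1.
have pj : par (pred1 j) p by apply: wfix; [exact: len0_cpl|exact: commute_sym].
have p1 : p = 1 by rewrite -pj retp.
have y1s : par (star j) y1.
  have -> : y1 = ret (star j) y1 * p by rewrite mulVKg.
  by rewrite p1 mulg1; exact: par_ret.
by rewrite -[y](conjgK h); apply: parJ => //; apply/parV/base_star.
Qed.

(** After conjugation by [h], the commutator fixes the axis of [w] and so lies in [G j] by
    [link_lox]; it also lies in the span of the link, which meets [G j] trivially. *)
Lemma link_centralizer_abelian j w y z : par (link j) w -> ~ vertexlike w ->
  par (link j) y -> par (link j) z -> commute w y -> commute w z -> commute y z.
Proof.
move=> wj nw yj zj wy wz; have [h [m [hj jm lw wfix]]] := link_lox wj nw.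
suff : [~ y ^ h, z ^ h] = 1.
  by rewrite -conjRg => /eqP; rewrite conjg_eq1 => /commgP.
have wy1 : commute (w ^ h) (y ^ h) by exact: commuteJ.
have wz1 : commute (w ^ h) (z ^ h) by exact: commuteJ.
have c0 := lox_comm_commg (len_gprE n_ge5 m) (len_one n_ge5 G m)
  (gpr_ultram n_ge5 m) lw wy1 wz1.
apply: (@par_and1 _ _ (pred1 j) (link j)).
- by move=> i /eqP ->; rewrite /link /= (adj_irr n_ge5).
- apply: wfix; first exact: len0_cpl.
  apply: commute_sym; rewrite /commg /conjg.
  by do !apply: commuteM => //; apply: commuteV.
- by rewrite /par/= retR !retJ yj zj hj.
Qed.

(** Otherwise [x] can be conjugated off each single index; retractions then remove the indices one
    after the other, until [x = 1]. *)
Lemma lox_or_star x : x <> 1 -> (forall j q, ~ lox (len j) (x ^ q)) ->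
  exists j q, par (star j) (x ^ q).
Proof.
move=> x1 nl; apply: contrapT => ns.
have cpl j : exists q, par (predC1 j) (x ^ q).
  have [|q _ qmin] := ex_min_nat (P := fun _ => True) (fun h => len j (x ^ h)).
    by exists 1.
  have [g|/nl//|xc|[r sr]] := min_len_lox n_ge5 (j := j) (x := x ^ q).
  - by rewrite -conjgM; exact: qmin.
  - by exists q.
  - by case: ns; exists j, (q * r); rewrite conjgM.
have step k : (k <= n)%N -> exists q, par (fun i : 'I_n => (k <= i)%N) (x ^ q).
  elim: k => [|k IHk] kn; first by exists 1; rewrite conjg1 /par/= ret_predT.
  have [q xq] := IHk (ltnW kn); have [r xr] := cpl (Ordinal kn).
  pose t := ret (predC1 (Ordinal kn)) (q^-1 * r); exists (r * t^-1).
  have e : x ^ (r * t^-1) = ret (predC1 (Ordinal kn)) (x ^ q).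
    have er : x ^ r = (x ^ q) ^ (q^-1 * r) by rewrite -conjgM mulVKg.
    by rewrite conjgM -xr er (retJ _ (x ^ q)) conjgK.
  rewrite e; apply: (ret_par xq) => i /=; rewrite -val_eqE /=; lia.
have [q xq] := step n (leqnn n).
apply: x1; apply/eqP; rewrite -(conjg_eq1 _ q); apply/eqP.
by apply: (par_eq1 xq) => i; have := ltn_ord i; lia.
Qed.

Lemma product_in_star (B : set C) x b0 b1 : is_subgroup B -> x <> 1 ->
  (forall b, B b -> commute x b) -> B b0 -> B b1 -> ~ commute b0 b1 ->
  exists g m, forall y, (B y \/ (forall b, B b -> commute b y)) ->
    par (star m) (y ^ g).
Proof.
move=> [B1 BM BV] x1 xB Bb0 Bb1 nb01.
have BJ b b' : B b -> B b' -> B (b ^ b').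
  by move=> Bb Bb'; exact: (BM _ _ (BV _ Bb') (BM _ _ Bb Bb')).
have BR : B [~ b0, b1] by rewrite commgEl; apply: BM; [exact: BV|exact: BJ].
(* If [x] is loxodromic, the commutator of [b0] and [b1] fixes its axis. It will be shown
   vertexlike, and centralizers of vertexlike elements lie in conjugates of star subgroups. *)
have [[j [q lx]]|nl] := pselect (exists j q, lox (len j) (x ^ q)).
  set c := [~ b0, b1] in BR.
  have c1 : c <> 1 by move=> /eqP/commgP.
  have cc : par (predC1 j) (c ^ q).
    apply: len0_cpl => //; rewrite conjRg.
    apply: (lox_comm_commg (len_gprE n_ge5 j) (len_one n_ge5 G j)
      (gpr_ultram n_ge5 j) lx); apply: commuteJ; exact: xB.
  have [h [m cm]] : vertexlike (c ^ q).
    have xT : par predT (x ^ q) by exact: ret_predT.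
    have [p1 [p2 [S1 S2 np12 fixc]]] := lox_fix n_ge5 xT lx.
    have [|d1 d2] := fixc _ cc; first exact/commuteJ/commute_sym/xB.
    set d := (c ^ q) ^ p1 in d1; pose t := p1^-1 * p2.
    have tc : par (predC1 j) t.
      apply: parM; first apply: parV.
        by apply: par_sub S1 => i /andP[].
      by apply: par_sub S2 => i /andP[].
    (* Both [d] and [d ^ t] lie in the span of the link, so [t] conjugates [d] as its own retraction
       does. If [d] is not vertexlike, [link_centralizer] puts [t] into the star subgroup, against
       [np12]. *)
    apply: contrapT => nv.
    have nd : ~ vertexlike d by rewrite vertexlikeJ.
    have dt : commute d (t * (ret (link j) t)^-1).
      apply: eq_conj_comm; have e : d ^ t = (c ^ q) ^ p2 by rewrite /d -conjgM mulVKg.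
      by rewrite -{2}d1 -retJ e.
    apply: np12; rewrite -/t.
    have ts : par (star j) t.
      rewrite -[t](mulgVK (ret (link j) t)); apply: parM.
        exact: link_centralizer dt.
      exact/base_star/par_ret.
    by apply: par_and ts tc => i /orP[/eqP ->|//]; rewrite /= eqxx.
  exists (q * h), m => y [By|yB]; last first.
    rewrite conjgM; apply: (vtx_comm_star (c := c ^ q)) => //; first exact: neq1J.
    exact/commuteJ/yB.
  have xs : par (star m) (x ^ (q * h)).
    rewrite conjgM; apply: (vtx_comm_star (c := c ^ q)) => //; first exact: neq1J.
    exact/commuteJ/commute_sym/xB.
  have xy : commute (x ^ (q * h)) (y ^ (q * h)) by exact/commuteJ/xB.
  have [xv|/eqP xv] := eqVneq (ret (pred1 m) (x ^ (q * h))) 1; last exact: star_comm xy.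
  apply: (link_centralizer (w := x ^ (q * h))) xy.
    by rewrite (par_star_split n_ge5 xs) xv mul1g; exact: par_ret.
  by rewrite vertexlikeJ; exact: lox_not_vertexlike lx.
have {}nl j q : ~ lox (len j) (x ^ q) by move=> lx; apply: nl; exists j, q.
(* If the first star found gives a trivial central component, [x] is vertexlike by [link_lox], and
   the star of its own index serves. *)
have [g [m [xs xv]]] : exists g m, par (star m) (x ^ g) /\ ret (pred1 m) (x ^ g) <> 1.
  have [j [q xs]] := lox_or_star x1 nl.
  have [xv|/eqP xv] := eqVneq (ret (pred1 j) (x ^ q)) 1; last by exists q, j.
  have xl : par (link j) (x ^ q).
    by rewrite (par_star_split n_ge5 xs) xv mul1g; exact: par_ret.
  have [[h [m xm]]|nv] := pselect (vertexlike (x ^ q)).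
    exists (q * h), m; rewrite conjgM; split; first exact: vtx_star.
    by rewrite xm; do 2!apply: neq1J.
  have [h [m [_ _ lx _]]] := link_lox xl nv.
  by case: (nl m (q * h)); rewrite conjgM.
have Bs b : B b -> par (star m) (b ^ g).
  by move=> Bb; apply: (star_comm n_ge5 xs xv); exact/commuteJ/xB.
have [[b Bb bv]|nv] := pselect (exists2 b, B b & ret (pred1 m) (b ^ g) <> 1).
  exists g, m => y [/Bs//|yB]; apply: (star_comm n_ge5 (Bs _ Bb) bv).
  exact/commuteJ/yB.
have Bl b : B b -> par (link m) (b ^ g).
  move=> Bb; rewrite (par_star_split n_ge5 (Bs _ Bb)).
  rewrite (_ : ret (pred1 m) (b ^ g) = 1) ?mul1g; first exact: par_ret.
  by apply: contrapT => bv; apply: nv; exists b.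
have [[b Bb nb]|allv] := pselect (exists2 b, B b & ~ vertexlike b).
  exists g, m => y [/Bs//|yB]; apply: (link_centralizer (Bl _ Bb)).
    by rewrite vertexlikeJ.
  exact/commuteJ/yB.
(* Now all of [B] is vertexlike. An element [y] of [B] outside the star subgroup around [b0] would
   make [b0 * b0 ^ y^-1] loxodromic up to conjugation. *)
have [h [k bk]] : vertexlike b0 by apply: contrapT => nb; apply: allv; exists b0.
have b01 : b0 <> 1 by move=> e; apply: nb01; rewrite e; exact/commute_sym/commute1.
exists h, k => y [By|yB]; last by apply: vtx_comm_star bk (yB _ Bb0).
apply: contrapT => ny.
have [q] := star_conj_prod n_ge5 bk (@neq1J _ _ _ h b01) ny.
rewrite -conjVg -conjJg -conjMg -conjgM => /lox_not_vertexlike; apply.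
apply: contrapT => nb; apply: allv; exists (b0 * b0 ^ y^-1) => //.
by apply: BM => //; apply: BJ => //; exact: BV.
Qed.

End Centralizers.

(** * Images of vertex groups under automorphisms *)

Section AutomorphismFacts.
Variable A : groupType.
Implicit Types (phi : automorphism A) (x y : A).

Lemma aut1E phi : phi 1 = 1.
Proof. by apply: (mulgI (phi 1)); rewrite -autM !mulg1. Qed.

Lemma autV phi x : phi x^-1 = (phi x)^-1.
Proof. by apply: (mulgI (phi x)); rewrite -autM !mulgV aut1E. Qed.

Lemma autJ phi x y : phi (x ^ y) = phi x ^ phi y.
Proof. by rewrite !conjgE !autM autV. Qed.

Lemma aut_inj phi : injective phi.
Proof. exact/bij_inj/aut_bij. Qed.

Lemma aut_neq1 phi x : x <> 1 -> phi x <> 1.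
Proof. by move=> x1; rewrite -(aut1E phi) => /aut_inj. Qed.

Lemma aut_commute phi x y : commute x y -> commute (phi x) (phi y).
Proof. by rewrite /commute -!autM => ->. Qed.

Lemma aut_image_subgroup phi (K : set A) :
  is_subgroup K -> is_subgroup [set phi x | x in K]%classic.
Proof.
move=> [K1 KM KV]; split.
- by exists 1; rewrite ?aut1E.
- by move=> _ _ [x Kx <-] [y Ky <-]; exists (x * y); rewrite ?autM//; exact: KM.
- by move=> _ [x Kx <-]; exists x^-1; rewrite ?autV//; exact: KV.
Qed.

End AutomorphismFacts.

Section AutomorphismImages.
Variables (n : nat) (n_ge5 : (5 <= n)%N) (G : 'I_n -> groupType).
Hypothesis G_nontrivial : forall i : 'I_n, exists a : G i, a <> 1.
Local Notation C := (cyclic_product G).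
Implicit Types (i j m u : 'I_n) (g h w x y z p q b c : C) (S T : pred 'I_n).
Implicit Types (phi psi : automorphism C).

Lemma vtx_nontrivial i : exists2 a : C, par (pred1 i) a & a <> 1.
Proof.
have [a a1] := G_nontrivial i; exists (cp_emb a); last exact: cp_emb_neq1.
by apply: par_emb; rewrite /= eqxx.
Qed.

Lemma vtx_type i T x g : par (pred1 i) x -> x <> 1 -> par T (x ^ g) -> T i.
Proof.
move=> xi x1 xT; apply: contraT => nT; case: (@neq1J _ _ _ g x1).
rewrite -xT retJ (ret_par1 xi) ?conj1g// => k Tk /eqP e.
by rewrite -e Tk in nT.
Qed.

Lemma vtx_not_comm i k a b : i != k -> ~~ adj i k -> par (pred1 i) a -> a <> 1 ->
  par (pred1 k) b -> b <> 1 -> ~ commute a b.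
Proof.
move=> ik nik ai a1 bk b1 ab; apply: b1.
have bi : par (star i) b.
  by apply: star_comm ab => //; [exact: vtx_star|rewrite ai].
apply: par_and1 bk bi => _ /eqP -> /orP[/eqP e|e]; last by rewrite e in nik.
by rewrite e eqxx in ik.
Qed.

Lemma nadj_pred_succ i : ~~ adj (ordS i) (ord_pred i).
Proof.
by apply/negP => e; exact: (adj_trifree n_ge5 (adjS i) e (adjP i)).
Qed.

Lemma vtx_normal i q y : par (star i) q -> par (pred1 i) y -> par (pred1 i) (y ^ q).
Proof.
move=> /(par_star_split n_ge5) -> yi; rewrite conjgM.
have e : par (pred1 i) (y ^ ret (pred1 i) q) by apply: parJ => //; exact: par_ret.
by rewrite conjg_comm//; apply: (vtx_base_comm e); exact: par_ret.
Qed.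

Lemma prod_not_vertexlike i k a b : i != k -> par (pred1 i) a -> a <> 1 ->
  par (pred1 k) b -> b <> 1 -> ~ vertexlike (a * b).
Proof.
move=> ik ai a1 bk b1 [h [m abm]].
have disj u v (c : C) : u != v -> par (pred1 v) c -> ret (pred1 u) c = 1.
  by move=> uv cv; apply: (ret_par1 cv) => _ /eqP -> /eqP e; rewrite e eqxx in uv.
have mi : i = m.
  apply/eqP; apply: contraT => im.
  case: (@neq1J _ _ _ (ret (pred1 i) h) a1).
  by rewrite -(disj _ _ _ im abm) retJ retM ai (disj _ _ _ ik bk) mulg1.
have mk : k = m.
  apply/eqP; apply: contraT => km.
  case: (@neq1J _ _ _ (ret (pred1 k) h) b1).
  rewrite -(disj _ _ _ km abm) retJ retM bk (disj _ _ _ _ ai) ?mul1g//.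
  by rewrite eq_sym.
by rewrite mi mk eqxx in ik.
Qed.

(** [product_in_star] with [B] the image of the span of the link: it is nonabelian because the two
    neighbours of [i] are not adjacent, and the image of [G i] centralizes it. *)
Lemma star_image phi i : exists g m, forall y, par (star i) y ->
  par (star m) (phi y ^ g).
Proof.
have [a ai a1] := vtx_nontrivial i.
have [b bi b1] := vtx_nontrivial (ordS i).
have [c ci c1] := vtx_nontrivial (ord_pred i).
have bl : par (link i) b by apply: par_sub bi => k /eqP ->; exact: adjS.
have cl : par (link i) c by apply: par_sub ci => k /eqP ->; exact: adjP.
have [||||||g [m gm]] := @product_in_star _ n_ge5 _
    [set phi x | x in par (link i)]%classic (phi a) (phi b) (phi c).
- exact/aut_image_subgroup/par_subgroup.
- exact: aut_neq1.
- by move=> _ [x xl <-]; apply/aut_commute/(vtx_base_comm ai).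
- by exists b.
- by exists c.
- move=> e; have : commute b c by apply: (@aut_inj _ phi); rewrite !autM.
  by apply: vtx_not_comm bi b1 ci c1; [exact: ordS_neq_pred|exact: nadj_pred_succ].
exists g, m => y /(par_star_split n_ge5) ->; rewrite autM conjMg.
apply: parM; apply: gm; last by left; exists (ret (link i) y); [exact: par_ret|].
right=> _ [x xl <-]; apply/aut_commute/commute_sym/(vtx_base_comm _ xl).
exact: par_ret.
Qed.

Lemma star_link i : subpred (link i) (star i).
Proof. by move=> k ik; rewrite /star /= orbC; apply/orP; left. Qed.

(** Conjugation preserves the indices seen by retractions, so [i] and both its neighbours lie in the
    star of [m]; without triangles this forces [i = m]. Then [star_conj] applies. *)
Lemma star_sub_star i m g : (forall y, par (star i) y -> par (star m) (y ^ g)) ->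
  i = m /\ par (star i) g.
Proof.
move=> sub; have im : i = m.
  have [a ai a1] := vtx_nontrivial i.
  have [b bi b1] := vtx_nontrivial (ordS i).
  have [c ci c1] := vtx_nontrivial (ord_pred i).
  have /= ti := vtx_type ai a1 (sub _ (vtx_star ai)).
  have bs : par (star i) b.
    by apply: par_sub bi => k /eqP ->; apply: star_link; exact: adjS.
  have cs : par (star i) c.
    by apply: par_sub ci => k /eqP ->; apply: star_link; exact: adjP.
  have /= tb := vtx_type bi b1 (sub _ bs).
  have /= tc := vtx_type ci c1 (sub _ cs).
  case/orP: ti => [/eqP//|mi].
  have nb k : star m k -> adj i k -> k = m.
    by move=> /orP[/eqP//|mk] ik; case: (adj_trifree n_ge5 mi ik mk).
  case/eqP: (ordS_neq_pred n_ge5 i).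
  by rewrite (nb _ tb (adjS i)) (nb _ tc (adjP i)).
split=> //; have [a ai a1] := vtx_nontrivial i.
apply: (@star_conj _ n_ge5 _ _ a); rewrite ?ai//; first exact: vtx_star.
by rewrite im; apply: sub; exact: vtx_star.
Qed.

Lemma star_image_eq phi i : exists g m, forall y,
  par (star i) y <-> par (star m) (phi y ^ g).
Proof.
have [g [m gm]] := star_image phi i; exists g, m => y; split=> [/gm//|ym].
have [psi [phiK _]] := aut_inv_ex phi.
have [h [k hk]] := star_image psi m.
have e z : psi (phi z ^ g) ^ h = z ^ (psi g * h) by rewrite autJ phiK conjgM.
have [|ik sq] := @star_sub_star i k (psi g * h).
  by move=> z /gm/hk; rewrite e.
by subst k; move: ym => /hk; rewrite e => /(parJE _ sq).
Qed.

(* [par (link m)] is the free product of the two neighbours of [G m]. *)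
Lemma link_indecomposable m (K L : set C) k0 l0 :
  (forall x, K x -> par (link m) x) -> (forall x, L x -> par (link m) x) ->
  (forall x y, K x -> L y -> commute x y) ->
  (forall t, par (link m) t -> exists x y, [/\ K x, L y & t = x * y]) ->
  K k0 -> k0 <> 1 -> L l0 -> l0 <> 1 -> False.
Proof.
move=> Km Lm KL gen Kk0 k01 Ll0 l01.
have [b bi b1] := vtx_nontrivial (ordS m).
have [c ci c1] := vtx_nontrivial (ord_pred m).
have bl : par (link m) b by apply: par_sub bi => k /eqP ->; exact: adjS.
have cl : par (link m) c by apply: par_sub ci => k /eqP ->; exact: adjP.
have into_vtx x (D : set C) : par (link m) x -> x <> 1 -> vertexlike x ->
    (forall y, D y -> par (link m) y) -> (forall y, D y -> commute x y) ->
    exists h u, [/\ par (link m) h, par (pred1 u) (x ^ h) & forall y, D y -> par (pred1 u) (y ^ h)].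
  move=> xm x1 [h0 [u xu]] Dm xD; pose h := ret (link m) h0.
  have hm : par (link m) h by exact: par_ret.
  have xh : par (pred1 u) (x ^ h).
    have -> : x ^ h = ret (link m) (x ^ h0) by rewrite retJ xm.
    by apply: (ret_par xu).
  have mu : adj m u.
    have xmh : par (link m) (x ^ h) by exact: parJ.
    by apply: (vtx_type xh (@neq1J _ _ _ h x1) (g := 1)); rewrite conjg1.
  exists h, u; split=> // y Dy.
  have ym : par (link m) (y ^ h) by apply: parJ => //; exact: Dm.
  have yu : par (star u) (y ^ h) by apply: vtx_comm_star xh (xD _ Dy).
  apply: par_and ym yu => i mi /orP[//|ui].
  by case: (adj_trifree n_ge5 mu ui mi).
have final h u : (forall x, K x -> par (pred1 u) (x ^ h)) ->
    (forall y, L y -> par (pred1 u) (y ^ h)) -> False.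
  move=> Ku Lu; have tu t : par (link m) t -> par (pred1 u) (t ^ h).
    by move=> /gen[x [y [/Ku xu /Lu yu ->]]]; rewrite conjMg; exact: parM.
  have /eqP eb := vtx_type bi b1 (tu _ bl); have /eqP ec := vtx_type ci c1 (tu _ cl).
  by case/eqP: (ordS_neq_pred n_ge5 m); rewrite eb ec.
(* A vertexlike [k0] confines [K] and [L] to one conjugate of a single neighbour, too small for the
   span of both. *)
have [vk|nvk] := pselect (vertexlike k0).
  have [h [u [hm ku Lu]]] := into_vtx _ L (Km _ Kk0) k01 vk Lm (fun y => KL _ y Kk0).
  have vl : vertexlike l0 by exists h, u; exact: Lu.
  apply: (final h u _ Lu) => x Kx.
  have xu : par (star u) (x ^ h).
    by apply: vtx_comm_star l01 (Lu _ Ll0) _ => //; apply/commute_sym/KL.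
  have mu : adj m u.
    have kmh : par (link m) (k0 ^ h) by apply: parJ => //; exact: Km.
    by apply: (vtx_type ku (@neq1J _ _ _ h k01) (g := 1)); rewrite conjg1.
  apply: par_and (parJ (Km _ Kx) hm) xu => i mi /orP[//|ui].
  by case: (adj_trifree n_ge5 mu ui mi).
have [vl|nvl] := pselect (vertexlike l0).
  have [h [u [hm lu Ku]]] := into_vtx _ K (Lm _ Ll0) l01 vl Km
    (fun y Ky => commute_sym (KL _ _ Ky Ll0)).
  by apply: nvk; exists h, u; exact: Ku.
(* Otherwise both subgroups are abelian, so the span of the link is abelian too, although the two
   neighbours do not commute. *)
have Kab x y : K x -> K y -> commute x y.
  move=> Kx Ky; apply: (link_centralizer_abelian n_ge5 (Lm _ Ll0) nvl (Km _ Kx) (Km _ Ky));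
  by apply/commute_sym/KL.
have Lab x y : L x -> L y -> commute x y.
  by move=> Lx Ly; apply: (link_centralizer_abelian n_ge5 (Km _ Kk0) nvk (Lm _ Lx) (Lm _ Ly));
  apply: KL.
have [xb [yb [Kxb Lyb eb]]] := gen _ bl; have [xc [yc [Kxc Lyc ec]]] := gen _ cl.
apply: (vtx_not_comm (ordS_neq_pred n_ge5 m) (nadj_pred_succ m) bi b1 ci c1).
rewrite eb ec; apply: commuteM; apply: commuteMl.
- exact: Kab.
- exact/commute_sym/KL.
- exact: KL.
- exact: Lab.
Qed.

(** The map [th] sends [G i] and the span of its link to commuting subgroups that cover the span of
    the link of [m], so by [link_indecomposable] one image is trivial. A nontrivial image of [G i]
    will make two distinct star subgroups equal. *)
Lemma vertex_image phi i : exists g m, forall y,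
  par (pred1 i) y -> par (pred1 m) (phi y ^ g).
Proof.
have [g [m gm]] := star_image_eq phi i; exists g, m => a ai; apply: contrapT => na.
have [psi [phiK psiK]] := aut_inv_ex phi.
pose th y := ret (link m) (phi y ^ g).
have thM : {morph th : x y / x * y} by move=> x y; rewrite /th autM conjMg retM.
have [b bi b1] := vtx_nontrivial (ordS i).
have [c ci c1] := vtx_nontrivial (ord_pred i).
have bl : par (link i) b by apply: par_sub bi => k /eqP ->; exact: adjS.
have cl : par (link i) c by apply: par_sub ci => k /eqP ->; exact: adjP.
have vtxE y : par (star i) y -> th y = 1 -> par (pred1 m) (phi y ^ g).
  move=> /gm /(par_star_split n_ge5) e y1; rewrite e -/(th y) y1 mulg1.
  exact: par_ret.
have Lm y : par (link i) y -> par (pred1 m) (phi y ^ g).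
  move=> yl; apply: (vtxE y); first exact: base_star.
  apply: contrapT => y1.
  apply: (@link_indecomposable m [set th x | x in par (pred1 i)]%classic
    [set th x | x in par (link i)]%classic (th a) (th y)) => //.
  - by move=> _ [x _ <-]; exact: par_ret.
  - by move=> _ [x _ <-]; exact: par_ret.
  - move=> _ _ [x xi <-] [z zl <-]; apply/ret_commute/commuteJ/aut_commute.
    exact: (vtx_base_comm xi).
  - move=> t tm; pose z := psi (t ^ g^-1).
    have ez : phi z ^ g = t by rewrite /z psiK conjgKV.
    have zi : par (star i) z by apply/gm; rewrite ez; exact: base_star.
    exists (th (ret (pred1 i) z)), (th (ret (link i) z)); split.
    + by exists (ret (pred1 i) z); [exact: par_ret|].
    + by exists (ret (link i) z); [exact: par_ret|].
    + by rewrite -thM -par_star_split// /th ez.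
  - by exists a.
  - by move=> a1; apply: na; apply: vtxE => //; exact: vtx_star.
  - by exists y.
(* The link of [i] now goes into a conjugate of [G m], hence also into one of the star subgroup of
   [ordS m]. Pulled back by [psi], the star subgroups of [m] and [ordS m] both become that of
   [i]. *)
have [h [k hk]] := star_image_eq psi (ordS m).
pose q := psi g * h.
have e z : psi (phi z ^ g) ^ h = z ^ q by rewrite autJ phiK conjgM.
have lk y : par (link i) y -> par (star k) (y ^ q).
  move=> /Lm ym; rewrite -e -hk; apply: par_sub ym => _ /eqP ->.
  by rewrite /star /= adj_sym adjS orbT.
have tb := vtx_type bi b1 (lk _ bl); have tc := vtx_type ci c1 (lk _ cl).
have ek : k = i.
  have bc : adj (ordS i) (ord_pred i) = false by apply/negbTE/nadj_pred_succ.
  case/orP: tb => [/eqP eb|kb].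
    case/orP: tc => [/eqP ec|kc]; last by rewrite -eb bc in kc.
    by case/eqP: (ordS_neq_pred n_ge5 i); rewrite eb ec.
  case/orP: tc => [/eqP ec|kc]; first by rewrite -ec adj_sym bc in kb.
  apply: (adj_sqfree n_ge5 (i := ordS i) (k := ord_pred i)) => //.
  - by rewrite adj_sym.
  - by rewrite adj_sym adjP.
  - exact: adjS.
  - exact: ordS_neq_pred.
subst k.
have qs : par (star i) q.
  have wl : par (link i) (b * c) by exact: parM.
  have nw : ~ vertexlike (b * c).
    by apply: prod_not_vertexlike bi b1 ci c1; exact: ordS_neq_pred.
  rewrite -[q](mulgVK (ret (star i) q)); apply: parM; last exact: par_ret.
  apply: (link_centralizer n_ge5 wl nw); apply: eq_conj_comm.
  by rewrite -[in LHS](lk _ wl) retJ (base_star wl).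
have mE z : par (star m) z <-> par (star (ordS m)) z.
  have ez : phi (psi (z ^ g^-1)) ^ g = z by rewrite psiK conjgKV.
  by rewrite -{1}ez -gm hk -{2}ez e (parJE _ qs).
have [d dm d1] := vtx_nontrivial (ord_pred m).
have ds : par (star (ordS m)) (d ^ 1).
  rewrite conjg1 -mE; apply: par_sub dm => _ /eqP ->.
  by rewrite /star /= adjP orbT.
have := vtx_type dm d1 ds; rewrite /star /= (negbTE (nadj_pred_succ m)) orbF eq_sym.
by rewrite (negbTE (ordS_neq_pred n_ge5 m)).
Qed.

Lemma vertex_image_eq phi i : exists g m, forall y,
  par (pred1 i) y <-> par (pred1 m) (phi y ^ g).
Proof.
have [g [m gm]] := vertex_image phi i; exists g, m => y; split=> [/gm//|ym].
have [psi [phiK _]] := aut_inv_ex phi.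
have [h [k hk]] := vertex_image psi m.
have e z : psi (phi z ^ g) ^ h = z ^ (psi g * h) by rewrite autJ phiK conjgM.
have [a ai a1] := vtx_nontrivial i.
have ak : par (pred1 k) (a ^ (psi g * h)) by rewrite -e; exact/hk/gm.
have /eqP ek := vtx_type ai a1 ak; subst k.
have sq : par (star i) (psi g * h).
  by apply: (@star_conj _ n_ge5 _ _ a); rewrite ?ai//; exact: vtx_star.
move: ym => /hk; rewrite e => /(vtx_normal (parV sq)).
by rewrite conjgK.
Qed.

End AutomorphismImages.

(** * Simultaneous standard position *)

Section CyclicIndices.
Variables (n : nat) (n_ge5 : (5 <= n)%N).
Implicit Types (c i y : 'I_n) (t : nat).

Lemma val_iter_ordS c t : (t <= n)%N ->
  iter t (@ordS n) c = (if c + t < n then c + t else c + t - n)%N :> nat.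
Proof.
elim: t => [|t IHt] tn; first by rewrite addn0 /=; have := ltn_ord c; case: ltnP.
rewrite iterS (val_ordS n_ge5) IHt; last exact: ltnW.
by have := ltn_ord c; do !case: ifP; lia.
Qed.

Lemma iter_ordSn c : iter n (@ordS n) c = c.
Proof.
by apply/val_inj => /=; rewrite val_iter_ordS//; have := ltn_ord c; case: ifP; lia.
Qed.

Lemma iter_ordS_total c i : exists t, i = iter t (@ordS n) c.
Proof.
exists (if (c <= i)%N then i - c else i + n - c)%N; apply/val_inj => /=.
have lc := ltn_ord c; have li := ltn_ord i; case: ifP => ci; rewrite val_iter_ordS; try lia.
  by rewrite subnKC// li.
by case: ltnP; lia.
Qed.

Lemma ordS_const (T : Type) (f : 'I_n -> T) :
  (forall i, f (ordS i) = f i) -> forall i k, f i = f k.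
Proof.
move=> fS i k; have [t ->] := iter_ordS_total k i.
by elim: t => //= t <-.
Qed.

Lemma adj_iter_far c t y : (3 <= t)%N -> (t <= n - 3)%N -> adj c y ->
  star (iter t (@ordS n) c) y -> False.
Proof.
move=> t3 tn; rewrite /star /= !(adjE n_ge5) -val_eqE /=.
rewrite val_iter_ordS; last lia.
by have := ltn_ord c; have := ltn_ord y; case: ifP; lia.
Qed.

Lemma eq_iter_far c t : (2 <= t)%N -> (t <= n - 2)%N ->
  star (iter t (@ordS n) c) c -> False.
Proof.
move=> t2 tn; rewrite /star /= !(adjE n_ge5) -val_eqE /=.
rewrite val_iter_ordS; last lia.
by have := ltn_ord c; case: ifP; lia.
Qed.

Lemma adj_iter_near c t y : (t = 1 \/ t = 2)%N -> adj c y ->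
  star (iter t (@ordS n) c) y -> y = ordS c.
Proof.
move=> t12 cy ty; apply/val_inj; move: cy ty.
rewrite /star /= !(adjE n_ge5) -val_eqE /=.
rewrite val_iter_ordS; last lia.
rewrite -[LHS]/(nat_of_ord y) -[RHS]/(nat_of_ord (ordS c)) (val_ordS n_ge5).
by have := ltn_ord c; have := ltn_ord y; do !case: ifP; lia.
Qed.

Lemma adj_iter_near_pred c t y : (t = n - 1 \/ t = n - 2)%N -> adj c y ->
  star (iter t (@ordS n) c) y -> y = iter n.-1 (@ordS n) c.
Proof.
move=> t12 cy ty; apply/val_inj; move: cy ty.
rewrite /star /= !(adjE n_ge5) -val_eqE /=.
rewrite val_iter_ordS; last lia.
rewrite -[LHS]/(nat_of_ord y) -[RHS]/(nat_of_ord _) val_iter_ordS; last lia.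
by have := ltn_ord c; have := ltn_ord y; do !case: ifP; lia.
Qed.

Variables (sg : 'I_n -> 'I_n).
Hypothesis sg_inj : injective sg.
Hypothesis sg_adj : forall i k, adj i k -> adj (sg i) (sg k).

Lemma adj_sg i u : adj (sg i) u -> exists2 k, adj i k & u = sg k.
Proof.
move=> iu; have := adj_cases iu.
have := adj_cases (sg_adj (adjS i)); have := adj_cases (sg_adj (adjP i)).
have ne : sg (ordS i) != sg (ord_pred i).
  by rewrite (inj_eq sg_inj); exact: ordS_neq_pred.
move=> [] e1 [] e2 [] ->; first by exists (ord_pred i); rewrite ?adjP.
- by rewrite e1 e2 eqxx in ne.
- by exists (ord_pred i); rewrite ?adjP.
- by exists (ordS i); rewrite ?adjS.
- by exists (ordS i); rewrite ?adjS.
- by exists (ord_pred i); rewrite ?adjP.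
- by rewrite e1 e2 eqxx in ne.
- by exists (ordS i); rewrite ?adjS.
Qed.

Lemma star_sg i u : star (sg i) u -> exists2 k, star i k & u = sg k.
Proof.
move=> /orP[/eqP ->|/adj_sg[k ik ->]]; first by exists i; rewrite ?/star /= ?eqxx.
by exists k => //; rewrite /star /= ik orbT.
Qed.

(** By injectivity the image walk never turns back, so its direction is constant around the
    cycle. *)
Lemma sg_orientation :
  (forall i, sg (ordS i) = ordS (sg i)) \/ (forall i, sg i = ordS (sg (ordS i))).
Proof.
have dir i : sg (ordS i) = ordS (sg i) \/ sg i = ordS (sg (ordS i)).
  have [->|->] := adj_cases (sg_adj (adjS i)); first by left.
  by right; rewrite ord_predK.
have nn i : sg (ordS (ordS i)) <> sg i.
  move=> /sg_inj e; case/eqP: (ordS_neq_pred n_ge5 i).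
  by apply: (@ordS_inj n); rewrite ord_predK.
pose f i := sg (ordS i) == ordS (sg i).
have fS i : f (ordS i) = f i.
  apply/eqP/eqP => e.
    have [//|e'] := dir i; case: (nn i).
    by rewrite e e'.
  have [//|e'] := dir (ordS i); case: (nn i).
  by apply: (@ordS_inj n); rewrite -e' e.
have [fT|fF] := pselect (forall i, f i); first by left=> i; apply/eqP/fT.
right=> i; have [e|//] := dir i; case: fF => k.
by rewrite (ordS_const fS k i); apply/eqP.
Qed.

End CyclicIndices.

(** * One conjugator for the images of all vertex groups *)

Section StandardForm.
Variables (n : nat) (n_ge5 : (5 <= n)%N) (G : 'I_n -> groupType).
Hypothesis G_nontrivial : forall i : 'I_n, exists a : G i, a <> 1.
Local Notation C := (cyclic_product G).
Implicit Types (i j m u c : 'I_n) (g h w x y z : C) (S T : pred 'I_n).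

Section Circle.
Variables (sg : 'I_n -> 'I_n).
Hypothesis sg_inj : injective sg.
Hypothesis sg_adj : forall i k, adj i k -> adj (sg i) (sg k).
(** In the application [kap i] puts the images of [G i] and [G (ordS i)] in standard position
    together; [d i] compares two frames that are both standard at [ordS i]. *)
Variable kap : 'I_n -> C.
Let d i : C := (kap i)^-1 * kap (ordS i).
Hypothesis d_star : forall i, par (star (sg (ordS i))) (d i).

(** The transitions crossed lie in the stars at steps 3 to n - 3 from [c], which [T] avoids; for n =
    5 there are none. *)
Lemma kap_const c T :
  (forall t, (3 <= t)%N -> (t <= n - 3)%N ->
     forall u, T u -> star (sg (iter t (@ordS n) c)) u -> False) ->
  ret T (kap (iter 2 (@ordS n) c)) = ret T (kap (iter (n - 3) (@ordS n) c)).
Proof.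
move=> Tfar.
suff step t : (t.+2 <= n - 3)%N ->
    ret T (kap (iter 2 (@ordS n) c)) = ret T (kap (iter t.+2 (@ordS n) c)).
  by have -> : (n - 3 = (n - 5).+2)%N by [lia]; apply: step; lia.
elim: t => [//|t IHt] tn; rewrite IHt; last by lia.
apply/(mulgI (ret T (kap (iter t.+2 (@ordS n) c)))^-1); rewrite mulVg -retV -retM.
apply/esym/(ret_par1 (d_star (iter t.+2 (@ordS n) c))) => u.
by apply: (Tfar t.+3); lia.
Qed.

(* Around the cycle the [d i] multiply to 1, and only five consecutive ones
   survive the retraction to the two neighbours of a given index. *)
Lemma d_link i : exists x y, [/\ par (pred1 (sg i)) x,
  par (pred1 (sg (ordS (ordS i)))) y & ret (link (sg (ordS i))) (d i) = x * y].
Proof.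
pose c := ordS i; pose s t := iter t (@ordS n) c; pose S := link (sg c).
have sn1 : s n.-1 = i.
  apply: (@ordS_inj n); rewrite -/c -iterS prednK ?iter_ordSn//; lia.
have sn2 : ordS (s n.-2) = s n.-1 by rewrite /s -iterS prednK//; lia.
have sn3 : ordS (s (n - 3)) = s n.-2 by rewrite /s -iterS (_ : (n - 3).+1 = n.-2)//; lia.
have e := @kap_const c S; have {}e : ret S (kap (s 2)) = ret S (kap (s (n - 3))).
  apply: e => t t3 tn u /(adj_sg n_ge5 sg_inj sg_adj)[k ck ->].
  move=> /(star_sg n_ge5 sg_inj sg_adj)[k' tk' /sg_inj ek]; subst k'.
  exact: adj_iter_far tk'.
have near t : (t = 1 \/ t = 2)%N -> forall x, par (star (sg (s t))) x ->
    par (pred1 (sg (ordS c))) (ret S x).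
  move=> t12 x xt; apply: (ret_par xt) => u /(adj_sg n_ge5 sg_inj sg_adj)[k ck ->].
  move=> /(star_sg n_ge5 sg_inj sg_adj)[k' tk' /sg_inj ek]; subst k'.
  by rewrite /= (adj_iter_near n_ge5 t12 ck tk').
have nearp t : (t = n - 1 \/ t = n - 2)%N -> forall x, par (star (sg (s t))) x ->
    par (pred1 (sg i)) (ret S x).
  move=> t12 x xt; apply: (ret_par xt) => u /(adj_sg n_ge5 sg_inj sg_adj)[k ck ->].
  move=> /(star_sg n_ge5 sg_inj sg_adj)[k' tk' /sg_inj ek]; subst k'.
  by rewrite /= (adj_iter_near_pred n_ge5 t12 ck tk') -/(s _) sn1.
(* The cycle is walked backwards from [kap i] to [kap (ordS i)]: two transitions survive at each
   end, and between them the retraction of [kap] is constant. *)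
exists (ret S (d (s (n - 3)) * d (s n.-2)))^-1, (ret S (d c * d (ordS c)))^-1; split.
- apply/parV; rewrite retM; apply: parM.
    by apply: (nearp n.-2); [lia|rewrite -sn3; exact: d_star].
  by apply: (nearp n.-1); [lia|rewrite -sn2; exact: d_star].
- apply/parV; rewrite retM; apply: parM.
    by apply: (near 1%N); [left|exact: d_star].
  by apply: (near 2%N); [right|exact: d_star].
- rewrite /d !sn3 !sn2 sn1 -/c.
  have tele (x y z : C) : x^-1 * y * (y^-1 * z) = x^-1 * z by rewrite -!mulgA mulVKg.
  rewrite !tele !retM !retV -/(s 2) e !invgM !invgK !mulgA.
  by rewrite mulgK.
Qed.

(** The index [ordS i] lies only in its own star and in those of its two neighbours, so only three
    transitions survive the retraction. *)
Lemma d_vtx i : ret (pred1 (sg (ordS i))) (d (ord_pred i)) *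
  (ret (pred1 (sg (ordS i))) (d i) * ret (pred1 (sg (ordS i))) (d (ordS i))) = 1.
Proof.
pose c := ordS i; pose s t := iter t (@ordS n) c; pose S : pred 'I_n := pred1 (sg c).
have sn1 : s n.-1 = i.
  apply: (@ordS_inj n); rewrite -/c -iterS prednK ?iter_ordSn//; lia.
have sn2 : s n.-2 = ord_pred i.
  apply: (@ordS_inj n); rewrite ord_predK -sn1 /s -iterS prednK//; lia.
have sn3 : ordS (s (n - 3)) = ord_pred i.
  by rewrite -sn2 /s -iterS (_ : (n - 3).+1 = n.-2)//; lia.
have far t : (2 <= t)%N -> (t <= n - 2)%N -> forall u, S u -> star (sg (s t)) u -> False.
  move=> t2 tn _ /eqP -> /(star_sg n_ge5 sg_inj sg_adj)[k tk /sg_inj ek]; subst k.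
  exact: eq_iter_far tk.
have e : ret S (kap (s 2)) = ret S (kap (s (n - 3))).
  by apply: kap_const => t t3 tn; apply: far; lia.
have e2 : ret S (d (s (n - 3))) = 1.
  by apply: (ret_par1 (d_star _)) => u; rewrite sn3 -sn2; apply: far; lia.
rewrite -/c -/S -!retM /d ord_predK -/c.
have tele (x y z : C) : x^-1 * y * (y^-1 * z) = x^-1 * z by rewrite -!mulgA mulVKg.
have d1 k : ret S (d k) = 1 -> ret S (kap k) = ret S (kap (ordS k)).
  by rewrite /d retM retV => /mulg1_eq; rewrite invgK.
have e1 : ret S (d (s 1%N)) = 1.
  by apply: (ret_par1 (d_star _)) => u; apply: (far 2%N); lia.
rewrite !tele retM retV -[ordS c]/(s 1%N) (d1 _ e1) -[ordS (s 1%N)]/(s 2).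
by rewrite e (d1 _ e2) sn3 mulVg.
Qed.

(* Writing [d (i - 1) = r * p * q] with [r], [p], [q] in the groups of index [i],
   [i - 1], [i + 1], the element [kap i * q^-1 * p'], where [p'] is the [p] of the
   next index, does not depend on [i]. *)
Lemma kap_frame : exists gam, forall i, par (star (sg i)) ((kap i)^-1 * gam).
Proof.
pose q i := ret (pred1 (sg (ordS i))) (d (ord_pred i)).
pose p i := ret (pred1 (sg i)) (d i).
pose gam i := kap i * ((q i)^-1 * p i).
have adjsg k : adj (sg k) (sg (ordS k)) by apply/sg_adj/adjS.
have gamS i : gam (ordS i) = gam i.
  rewrite /gam /q /p ordSK.
  have [x [y [xi yi exy]]] := d_link i.
  have nij : sg i != sg (ordS (ordS i)).
    rewrite (inj_eq sg_inj); apply/eqP => e; case/eqP: (ordS_neq_pred n_ge5 (ordS i)).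
    by rewrite ordSK -e.
  have disj u v (w : C) : u != v -> par (pred1 v) w -> ret (pred1 u) w = 1.
    by move=> uv wv; apply: (ret_par1 wv) => _ /eqP -> /eqP e; rewrite e eqxx in uv.
  have xE : ret (pred1 (sg i)) (d i) = x.
    rewrite -(@ret_sub _ _ _ (link (sg (ordS i)))).
      by rewrite exy retM xi (disj _ _ _ nij yi) mulg1.
    by move=> u /eqP ->; rewrite /link /= adj_sym.
  have yE : ret (pred1 (sg (ordS (ordS i)))) (d i) = y.
    rewrite -(@ret_sub _ _ _ (link (sg (ordS i)))).
      by rewrite exy retM yi (disj _ _ _ _ xi) ?mul1g// eq_sym.
    by move=> u /eqP ->; rewrite /link /=.
  rewrite yE xE; have := d_vtx i.
  set r := ret _ (d i); set r' := ret _ (d (ordS i)); set r0 := ret _ _ => er.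
  have dE : d i = r * (x * y) by rewrite -exy; exact: par_star_split.
  have -> : kap (ordS i) = kap i * (r * (x * y)) by rewrite -dE mulVKg.
  have xr : commute x r'.
    apply: (@par_comm _ _ (pred1 (sg i)) (pred1 (sg (ordS i)))) => //.
      by move=> u v /eqP -> /eqP ->.
    exact: par_ret.
  (* This is [d_vtx]; as [x] commutes with [r'], both frames equal [kap i * r * r' * x]. *)
  have -> : r0^-1 = r * r' by apply: mulg1_eq.
  by rewrite -!mulgA (mulVKg y) xr.
have [i0] : exists i0 : 'I_n, True by exists (Ordinal (leq_trans (isT : 0 < 5)%N n_ge5)).
exists (gam i0) => i; rewrite (ordS_const n_ge5 gamS i0 i) /gam mulKg; apply: parM.
  apply/parV/(par_sub _ (par_ret _ _)) => u /eqP ->.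
  by rewrite /star /= adjsg orbT.
by apply: (par_sub _ (par_ret _ _)) => u /eqP ->; rewrite /star /= eqxx.
Qed.

End Circle.

Lemma vtx_conj_star i g e x : par (star i) e ->
  par (pred1 i) (x ^ (g * e)) <-> par (pred1 i) (x ^ g).
Proof.
move=> ie; rewrite conjgM; split; last exact: vtx_normal.
by move=> /(vtx_normal n_ge5 (parV ie)); rewrite conjgK.
Qed.

Lemma aut_standard (phi : automorphism C) : exists gam sg,
  [/\ forall i y, par (pred1 i) y <-> par (pred1 (sg i)) (phi y ^ gam),
      injective sg &
      (forall i, sg (ordS i) = ordS (sg i)) \/ (forall i, sg i = ordS (sg (ordS i)))].
Proof.
have /choice[f fP] : forall i, exists p : C * 'I_n, forall y,
    par (pred1 i) y <-> par (pred1 p.2) (phi y ^ p.1).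
  by move=> i; have [g [m gm]] := vertex_image_eq n_ge5 G_nontrivial phi i; exists (g, m).
pose gi i := (f i).1; pose sg i := (f i).2.
have {}fP i y : par (pred1 i) y <-> par (pred1 (sg i)) (phi y ^ gi i) by exact: fP.
have [psi [phiK psiK]] := aut_inv_ex phi.
have sg_inj : injective sg.
  move=> i k e; have [a ai a1] := vtx_nontrivial n_ge5 G_nontrivial i.
  have := (fP i a).1 ai; rewrite e => ak.
  pose y := psi ((phi a ^ gi i) ^ (gi k)^-1).
  have yk : par (pred1 k) y by apply/fP; rewrite psiK conjgKV.
  have ey : y = a ^ psi (gi i * (gi k)^-1) by rewrite /y -conjgM autJ phiK.
  by rewrite ey in yk; exact/eqP/(vtx_type ai a1 yk).
(* Images of commuting factors commute, which forces adjacency. Correcting [t] by its retraction to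
   the star of [sg i] gives one conjugator [gi i * r] for both indices. *)
have edge i k : adj i k -> adj (sg i) (sg k) /\ exists r s,
    [/\ par (star (sg i)) r, par (star (sg k)) s & gi i * r = gi k * s].
  move=> ik; have [a ai a1] := vtx_nontrivial n_ge5 G_nontrivial i.
  have [b bk b1] := vtx_nontrivial n_ge5 G_nontrivial k.
  have ab : commute a b.
    by apply: (par_comm _ ai bk) => u v /eqP -> /eqP ->.
  pose x := phi a ^ gi i; pose y := phi b ^ gi k; pose t := (gi k)^-1 * gi i.
  have xi : par (pred1 (sg i)) x by exact: (fP i a).1.
  have yk : par (pred1 (sg k)) y by exact: (fP k b).1.
  have x1 : x <> 1 by exact/neq1J/aut_neq1.
  have y1 : y <> 1 by exact/neq1J/aut_neq1.
  have yt : par (star (sg i)) (y ^ t).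
    apply: (star_comm n_ge5 (vtx_star xi)); first by rewrite xi.
    by rewrite /y /t -conjgM mulVKg; exact/commuteJ/aut_commute.
  have ikt := vtx_type yk y1 yt; split.
    case/orP: ikt => [/eqP/sg_inj e|//].
    by rewrite e adj_irr in ik.
  exists (ret (star (sg i)) t)^-1, (t * (ret (star (sg i)) t)^-1); split.
  - exact/parV/par_ret.
  - apply: (star_comm n_ge5 (vtx_star yk)); first by rewrite yk.
    apply: eq_conj_comm; rewrite -[LHS]yt retJ; congr (_ ^ _).
    by apply: (par_sub _ yk) => u /eqP ->.
  - by rewrite /t -!mulgA mulVKg.
have sg_adj i k : adj i k -> adj (sg i) (sg k) by move=> /edge[].
have /choice[kap kapP] : forall i, exists x : C,
    par (star (sg i)) ((gi i)^-1 * x) /\ par (star (sg (ordS i))) ((gi (ordS i))^-1 * x).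
  move=> i; have [_ [r [s [ri sk e]]]] := edge _ _ (adjS i).
  by exists (gi i * r); rewrite mulKg e mulKg.
have [|gam gamP] := @kap_frame sg sg_inj sg_adj kap.
  move=> i; have [_ k1] := kapP i; have [k2 _] := kapP (ordS i).
  have -> : (kap i)^-1 * kap (ordS i) =
      ((gi (ordS i))^-1 * kap i)^-1 * ((gi (ordS i))^-1 * kap (ordS i)).
    by rewrite invgM invgK -!mulgA mulVKg.
  by apply: parM => //; exact: parV.
exists gam, sg; split=> //; last exact: sg_orientation.
move=> i y; rewrite fP; have [k1 _] := kapP i.
have -> : gam = gi i * (((gi i)^-1 * kap i) * ((kap i)^-1 * gam)).
  by rewrite -!mulgA !mulVKg.
by rewrite vtx_conj_star//; apply: parM.
Qed.

End StandardForm.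

(** * The action on the complex *)

Lemma mul_conj_cancel (A : groupType) (k u v y z : A) :
  k * z = u * y * v -> k^-1 * u * v * y ^ v = z.
Proof.
by move=> e; apply: (mulgI k); rewrite e conjgE !mulgA mulgV mul1g mulgK.
Qed.

Section Action.
Variables (R : realType) (n : nat) (n_ge5 : (5 <= n)%N) (G : 'I_n -> groupType).
Hypothesis G_nontrivial : forall i : 'I_n, exists a : G i, a <> 1.
Local Notation C := (cyclic_product G).
Implicit Types (i j m u c : 'I_n) (g h w x y z k : C) (S T : pred 'I_n).
Implicit Types (phi psi : automorphism C) (gam : C) (sg : 'I_n -> 'I_n) (e : bool).

(** The bit [e] records whether [sg] keeps the orientation of the cycle; a reflection must exchange
    the two coordinates of each square. *)
Definition standard phi gam sg e :=
  [/\ forall i y, par (pred1 i) y <-> par (pred1 (sg i)) (phi y ^ gam),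
      injective sg &
      forall i, if e then sg (ordS i) = ordS (sg i) else sg i = ordS (sg (ordS i))].

Lemma standard_ex phi : exists p : C * ('I_n -> 'I_n) * bool,
  standard phi p.1.1 p.1.2 p.2.
Proof.
have [gam [sg [gamP sgI [sgS|sgS]]]] := aut_standard n_ge5 G_nontrivial phi.
  by exists (gam, sg, true).
by exists (gam, sg, false).
Qed.

Lemma ordS2_neq i : ordS (ordS i) <> i.
Proof.
move=> e; case/eqP: (ordS_neq_pred n_ge5 i).
by apply: (@ordS_inj n); rewrite e ord_predK.
Qed.

Lemma par_star2 j z : par (star (ord_pred j)) z -> par (star (ordS j)) z ->
  par (pred1 j) z.
Proof.
apply: par_and => i; have nb := nadj_pred_succ n_ge5 j; have ne := ordS_neq_pred n_ge5 j.
case/orP => [/eqP ->|pi] /orP[/eqP ei|si].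
- by rewrite ei eqxx in ne.
- by rewrite si in nb.
- by rewrite ei adj_sym (negbTE nb) in pi.
apply/eqP; apply: (adj_sqfree n_ge5 (k := ordS j) pi _ _ (adjP j)).
- by rewrite adj_sym.
- by rewrite adj_sym adjS.
- by rewrite eq_sym.
Qed.

(** The quotient [t] lies in every star subgroup, hence in every [G j] by [par_star2], and two of
    these meet trivially. *)
Lemma standard_uniq phi gam sg e gam' sg' e' :
  standard phi gam sg e -> standard phi gam' sg' e' ->
  [/\ gam = gam', sg =1 sg' & e = e'].
Proof.
move=> [gP sI sS] [gP' sI' sS'].
pose t := gam^-1 * gam'.
have tP i : sg i = sg' i /\ par (star (sg i)) t.
  have [a ai a1] := vtx_nontrivial n_ge5 G_nontrivial i.
  have x1 : phi a ^ gam <> 1 by exact/neq1J/aut_neq1.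
  have xi := (gP _ _).1 ai; have := (gP' _ _).1 ai.
  have -> : phi a ^ gam' = (phi a ^ gam) ^ t by rewrite -conjgM mulVKg.
  move=> xt; have /eqP ei := vtx_type xi x1 xt; split=> //.
  apply: (star_conj n_ge5 (vtx_star xi)); first by rewrite xi.
  by rewrite ei; exact: vtx_star.
have sE : sg =1 sg' by move=> i; case: (tP i).
have [i0] : exists i0 : 'I_n, True by exists (Ordinal (leq_trans (isT : 0 < 5)%N n_ge5)).
have t1 : t = 1.
  have [f fK fK'] : bijective sg := injF_bij sI.
  have all_star m : par (star m) t by rewrite -(fK' m); case: (tP (f m)).
  have tj j : par (pred1 j) t by exact: par_star2.
  apply: (par_and1 _ (tj i0) (tj (ordS i0))) => i /eqP -> /eqP ei.
  by have := adjS i0; rewrite -ei adj_irr.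
split=> //; first by apply/esym/(mulgI gam^-1); rewrite -/t t1 mulVg.
have := sS i0; have := sS' i0; rewrite -!sE.
case: e e' {sS sS'} => -[] //= e1 e2; case: (@ordS2_neq (sg i0)).
  by rewrite -e2 -e1.
by rewrite -e1 -e2.
Qed.

Lemma standard1 : standard (aut1 C) 1 id true.
Proof. by split=> // i y; rewrite conjg1. Qed.

Lemma standard_inner g : standard (inner g) g id true.
Proof. by split=> // i y; rewrite /= /inner_fun conjgE !mulgA mulgVK mulVg mul1g. Qed.

Lemma standardM phi psi gam sg e gam' sg' e' :
  standard phi gam sg e -> standard psi gam' sg' e' ->
  standard (aut_mul phi psi) (phi gam' * gam) (sg \o sg') (e == e').
Proof.
move=> [gP sI sS] [gP' sI' sS']; split; last 1 first.
- move=> i /=; have := sS' i; case: e sS => sS; case: (e') => /= sS'i.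
  + by rewrite sS'i sS.
  + by rewrite sS'i sS.
  + by rewrite sS'i sS.
  + by rewrite (sS (sg' (ordS i))) sS'i.
- by move=> i y; rewrite gP' gP autJ conjgM.
- exact: inj_comp.
Qed.

Definition edge i : pred 'I_n := [pred k | (k == i) || (k == ordS i)].

(** A pair of adjacent indices is named by its first one along the cycle, which is [sg (ordS i)] for
    a reflection. *)
Definition corner sg e i := if e then sg i else sg (ordS i).

Lemma edge_split i y : par (edge i) y ->
  y = ret (pred1 i) y * ret (pred1 (ordS i)) y.
Proof.
move=> yi; rewrite -(@ret_split _ n_ge5 _ _ _ (edge i))//.
by move=> a b /eqP -> /eqP ->; exact: adjS.
Qed.

Lemma corner_edge phi gam sg e i u : standard phi gam sg e ->
  edge (corner sg e i) u = (u == sg i) || (u == sg (ordS i)).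
Proof.
by move=> [_ _ /(_ i)]; rewrite /edge /corner /=; case: e => <-//; rewrite orbC.
Qed.

Lemma standard_edge phi gam sg e i y : standard phi gam sg e ->
  par (edge i) y <-> par (edge (corner sg e i)) (phi y ^ gam).
Proof.
move=> st; have [gP sI sS] := st; have cE := corner_edge i _ st; split=> yi.
  rewrite (edge_split yi) autM conjMg; apply: parM.
    apply: (@par_sub _ _ (pred1 (sg i))) => [u /eqP ->|]; first by rewrite cE eqxx.
    apply: (gP _ _).1; exact: par_ret.
  apply: (@par_sub _ _ (pred1 (sg (ordS i)))) => [u /eqP ->|]; first by rewrite cE eqxx orbT.
  apply: (gP _ _).1; exact: par_ret.
have [psi [phiK psiK]] := aut_inv_ex phi.
pose z := phi y ^ gam; pose back x := psi (x ^ gam^-1).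
have backK x : phi (back x) ^ gam = x by rewrite psiK conjgKV.
have zE : z = ret (pred1 (sg i)) z * ret (pred1 (sg (ordS i))) z.
  rewrite -(@ret_split _ n_ge5 _ _ _ (edge (corner sg e i)))//.
    move=> a b /eqP -> /eqP ->; have := sS i; case: (e) => ->.
      exact: adjS.
    by rewrite adj_sym adjS.
have -> : y = back (ret (pred1 (sg i)) z) * back (ret (pred1 (sg (ordS i))) z).
  apply: (@aut_inj _ phi); apply: (@conjg_inj _ gam).
  by rewrite autM conjMg !backK -zE.
apply: parM.
  apply: (@par_sub _ _ (pred1 i)) => [u /eqP ->|]; first by rewrite /edge /= eqxx.
  by apply: (gP _ _).2; rewrite backK; exact: par_ret.
apply: (@par_sub _ _ (pred1 (ordS i))) => [u /eqP ->|]; first by rewrite /edge /= eqxx orbT.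
by apply: (gP _ _).2; rewrite backK; exact: par_ret.
Qed.

Lemma coset_vertex_eq g h i :
  coset_vertex g i = coset_vertex h i <-> par (edge i) (g^-1 * h).
Proof.
rewrite /coset_vertex pair_subgroupE; apply: lcoset_eq; exact: par_subgroup.
Qed.

Lemma standard_coset phi gam sg e g h i : standard phi gam sg e ->
  coset_vertex g i = coset_vertex h i ->
  coset_vertex (phi g * gam) (corner sg e i) =
  coset_vertex (phi h * gam) (corner sg e i).
Proof.
move=> st /coset_vertex_eq /(standard_edge i _ st) gh; apply/coset_vertex_eq.
by move: gh; rewrite autM autV conjgE invgM !mulgA.
Qed.

Definition square_swap (e : bool) (a : ({i01 R} * {i01 R})%type) := if e then a else (a.2, a.1).

Definition square_act phi gam sg e (p : square_point R G) : square_point R G :=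
  (phi p.1.1 * gam, corner sg e p.1.2, square_swap e p.2).

(** A reflection exchanges [glue_edge_next] with [glue_edge_prev] and reverses the spokes. *)
Lemma square_act_glue phi gam sg e p q : standard phi gam sg e ->
  Defs.glue p q ->
  Defs.glue (square_act phi gam sg e p) (square_act phi gam sg e q).
Proof.
move=> st; have [_ _ sS] := st; have cos := standard_coset st.
have cS i : ~~ e -> ordS (sg (ordS (ordS i))) = sg (ordS i).
  by move=> eF; have := sS (ordS i); rewrite (negbTE eF).
elim=> {p q}.
- by move=> p; exact: glue_refl.
- by move=> p q _; exact: glue_sym.
- by move=> p q r _ pq _; exact: glue_trans.
- move=> g i t; rewrite /square_act /=; case: (boolP e) (sS i) => [eT|eF] sSi /=.
    by rewrite /corner sSi; exact: glue_spoke.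
  by rewrite /corner -cS//; exact/glue_sym/glue_spoke.
- move=> g h i /cos gh; rewrite /square_act /=.
  rewrite (_ : square_swap e _ = (unit1 R, unit1 R)); last by case: (e).
  exact: glue_vertex.
- move=> g h i s /cos gh /cos gh'; rewrite /square_act /=.
  case: (boolP e) gh gh' => [eT|eF]; rewrite /corner ?eT ?(negbTE eF) => gh gh' /=.
    apply: glue_edge_next => //; by have := sS i; rewrite eT => <-.
  rewrite -(cS _ eF); apply: glue_edge_prev => //; by rewrite cS.
- move=> g h i s /cos gh /cos gh'; rewrite /square_act /=.
  case: (boolP e) gh gh' => [eT|eF]; rewrite /corner ?eT ?(negbTE eF) => gh gh' /=.
    have := sS i; rewrite eT => sSi; rewrite sSi in gh' *.
    by apply: glue_edge_prev.
  by apply: glue_edge_next => //; rewrite cS.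
Qed.

Definition std_data phi : C * ('I_n -> 'I_n) * bool := projT1 (cid (standard_ex phi)).

Lemma std_dataP phi :
  standard phi (std_data phi).1.1 (std_data phi).1.2 (std_data phi).2.
Proof. by rewrite /std_data; case: cid. Qed.

Definition davis_act phi (x : davis R G) : davis R G :=
  davis_point (square_act phi (std_data phi).1.1 (std_data phi).1.2 (std_data phi).2 (repr x)).

Lemma davis_pointK (x : davis R G) : davis_point (repr x) = x.
Proof. by rewrite /davis_point reprK. Qed.

(** By [standard_uniq] any standard data computes the action; the action law and the case of inner
    automorphisms rest on this. *)
Lemma davis_actE phi gam sg e p : standard phi gam sg e ->
  davis_act phi (davis_point p) = davis_point (square_act phi gam sg e p).
Proof.
move=> st; have [eg es ee] := standard_uniq (std_dataP phi) st.
have -> : square_act phi gam sg e p =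
    square_act phi (std_data phi).1.1 (std_data phi).1.2 (std_data phi).2 p.
  by rewrite /square_act /corner eg ee !es.
apply/davis_piP/(square_act_glue (std_dataP phi))/davis_piP.
exact: davis_pointK.
Qed.

Lemma davis_act_action : is_action davis_act.
Proof.
split=> [x|phi psi x]; rewrite -[x]davis_pointK; case: (repr x) => -[g i] a.
  by rewrite (davis_actE _ standard1) /square_act /= mulg1.
have sp := std_dataP phi; have sq := std_dataP psi; have spq := standardM sp sq.
rewrite (davis_actE _ sq) (davis_actE _ sp) (davis_actE _ spq).
congr davis_point; rewrite /square_act /=.
have [_ _ sS] := sp; have [_ _ sS'] := sq.
rewrite autM mulgA; congr (_, _, _).
  rewrite /corner /=; have := sS'; case: (std_data psi).2 => s'.
    by case: (std_data phi).2 => //=; rewrite s'.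
  by case: (std_data phi).2 => //=; rewrite -s'.
by case: (std_data psi).2; case: (std_data phi).2 => //=; rewrite -surjective_pairing.
Qed.

Lemma square_distC (a b : ({i01 R} * {i01 R})%type) e :
  square_dist (square_swap e a) (square_swap e b) = square_dist a b.
Proof. by case: e => //; rewrite /square_dist /= GRing.addrC. Qed.

Lemma path_length_act phi (x y : davis R G) l :
  path_length x y l -> path_length (davis_act phi x) (davis_act phi y) l.
Proof.
elim=> [|l' g i a b _]; first exact: path_nil.
rewrite !(davis_actE _ (std_dataP phi)) /square_act /=.
by move=> IH; rewrite -(square_distC a b (std_data phi).2); exact: path_step.
Qed.

Lemma davis_act_isometry phi (x y : davis R G) :
  davis_dist (davis_act phi x) (davis_act phi y) = davis_dist x y.
Proof.
have [act1 actM] := davis_act_action.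
have actK (z : davis R G) : davis_act phi^-1 (davis_act phi z) = z by rewrite -actM mulVg act1.
congr inf; apply/seteqP; split=> l /=; last exact: path_length_act.
by move=> /(path_length_act phi^-1); rewrite !actK.
Qed.

Lemma rtranslate_coset phi gam sg e k i : standard phi gam sg e ->
  rtranslate (lcoset (phi k) (phi @` pair_subgroup G i)) gam =
  coset_vertex (phi k * gam) (corner sg e i).
Proof.
move=> st; rewrite /coset_vertex !pair_subgroupE; apply/seteqP; split.
  move=> _ [_ [_ [y yi <-] <-] <-]; exists (phi y ^ gam).
    exact/(standard_edge i _ st).
  by rewrite conjgE !mulgA mulgK.
have [psi [phiK psiK]] := aut_inv_ex phi.
move=> _ [z zi <-]; have ez : phi (psi (z ^ gam^-1)) = gam * z * gam^-1.
  by rewrite psiK conjgE invgK mulgA.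
exists (phi k * (gam * z * gam^-1)); last by rewrite !mulgA mulgVK.
exists (gam * z * gam^-1) => //; exists (psi (z ^ gam^-1)) => //.
by apply/(standard_edge i _ st); rewrite psiK conjgKV.
Qed.

(** Applied at [i] and at [ordS i], [star_conj] puts [v] in two star subgroups that meet in the span
    of these two indices. This makes the vertex designated by a set unique. *)
Lemma edge_conj i i' v : (forall y, par (edge i) y -> par (edge i') (y ^ v)) ->
  i = i' /\ par (edge i) v.
Proof.
move=> sub; have [a ai a1] := vtx_nontrivial n_ge5 G_nontrivial i.
have [b bi b1] := vtx_nontrivial n_ge5 G_nontrivial (ordS i).
have ae : par (edge i) a by apply: par_sub ai => u /eqP ->; rewrite /edge /= eqxx.
have be : par (edge i) b by apply: par_sub bi => u /eqP ->; rewrite /edge /= eqxx orbT.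
have ta := vtx_type ai a1 (sub _ ae); have tb := vtx_type bi b1 (sub _ be).
have ei : i = i'.
  case/orP: ta => [/eqP//|/eqP ea]; case/orP: tb => /eqP eb.
    by case: (@ordS2_neq i'); rewrite -ea eb.
  by apply: (@ordS_inj n).
split=> //; subst i'.
have es u : edge i u -> star i u /\ star (ordS i) u.
  move=> /orP[/eqP ->|/eqP ->]; rewrite /star /=.
    by rewrite eqxx adj_sym adjS orbT.
  by rewrite eqxx adjS orbT.
have va : par (star i) v.
  apply: (star_conj n_ge5 (vtx_star ai)); first by rewrite ai.
  by apply: par_sub (sub _ ae) => u /es[].
have vb : par (star (ordS i)) v.
  apply: (star_conj n_ge5 (vtx_star bi)); first by rewrite bi.
  by apply: par_sub (sub _ be) => u /es[].
apply: par_and va vb => u /orP[/eqP -> _|iu /orP[/eqP ->|su]].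
- by rewrite /edge /= eqxx.
- by rewrite /edge /= eqxx orbT.
- by case: (adj_trifree n_ge5 (adjS i) su iu).
Qed.

Lemma designates_act phi k i (x : davis R G) :
  designates (lcoset (phi k) (phi @` pair_subgroup G i)) x <->
  x = davis_act phi (davis_vertex R k i).
Proof.
pose gam := (std_data phi).1.1; pose sg := (std_data phi).1.2; pose e := (std_data phi).2.
have st : standard phi gam sg e := std_dataP phi.
have actE : davis_act phi (davis_vertex R k i) =
    davis_vertex R (phi k * gam) (corner sg e i).
  by rewrite /davis_vertex (davis_actE _ st) /square_act /=; case: (e).
rewrite actE; split; last first.
  by move=> ->; exists gam, (phi k * gam), (corner sg e i); rewrite -rtranslate_coset.
move=> [g [k' [i' [+ ->]]]].
pose K := lcoset (phi k) (phi @` pair_subgroup G i).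
(* [v] compares the given right translate with the standard one; by [edge_conj] it lies in the
   subgroup of the vertex, so the coset is the same. *)
pose v := gam^-1 * g; pose u := phi k * gam; pose c := corner sg e i.
have -> : rtranslate K g = rtranslate (coset_vertex u c) v.
  rewrite -(rtranslate_coset k i st) -/K.
  apply/seteqP; split=> [_ [z Kz <-]|_ [_ [z Kz <-] <-]].
    by exists (z * gam); [exists z|rewrite /v -mulgA mulVKg].
  by exists z => //; rewrite /v -mulgA mulVKg.
rewrite /coset_vertex !pair_subgroupE => ev.
have mem y : par (edge c) y -> par (edge i') ((k'^-1 * u * v) * (y ^ v)).
  move=> yc; have : lcoset k' (par (edge i')) (u * y * v).
    by rewrite -ev; exists (u * y) => //; exists y.
  move=> [z zi ez]; suff -> : k'^-1 * u * v * y ^ v = z by [].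
  exact: mul_conj_cancel.
have uv : par (edge i') (k'^-1 * u * v).
  by have := mem 1 (par1 _ _); rewrite conj1g mulg1.
have [ec vc] : c = i' /\ par (edge c) v.
  apply: edge_conj => y /mem yi; rewrite -[y ^ v](mulKg (k'^-1 * u * v)).
  by apply: parM => //; exact: parV.
apply/davis_piP; rewrite -/c -/u ec; apply: glue_vertex; apply/coset_vertex_eq.
rewrite ec in vc; rewrite -[k'^-1 * u](mulgK v); apply: parM => //; exact: parV.
Qed.

Lemma davis_act_inner g (x : davis R G) : davis_act (inner g) x = davis_lmul g x.
Proof.
rewrite -[x]davis_pointK (davis_actE _ (standard_inner g)) davis_lmulE.
congr davis_point; rewrite /square_act /square_lmul /= /inner_fun mulgVK.
by case: (repr x) => -[].
Qed.

End Action.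

Theorem corollary4p2 (R : realType) (n : nat) (n_ge5 : (5 <= n)%N)
    (G : 'I_n -> groupType)
    (G_nontrivial : forall i : 'I_n, exists a : G i, a <> 1%g) :
  exists act : automorphism (cyclic_product G) -> davis R G -> davis R G,
    [/\ is_action act,
        (forall (phi : automorphism (cyclic_product G)) (x y : davis R G),
            davis_dist (act phi x) (act phi y) = davis_dist x y),
        (forall (phi : automorphism (cyclic_product G)) (k : cyclic_product G)
            (i : 'I_n) (x : davis R G),
            designates (lcoset (phi k) (image (pair_subgroup G i) phi)) x
            <-> x = act phi (davis_vertex R k i)) &
        (forall (g : cyclic_product G) (x : davis R G),
            act (inner g) x = davis_lmul g x)].
Proof.
exists (davis_act n_ge5 G_nontrivial); split.
- exact: davis_act_action.
- exact: davis_act_isometry.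
- exact: designates_act.
- exact: davis_act_inner.
Qed.
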